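(* Let $a\in\mathbb{R}$ and let $g_1(x)=\dfrac{1}{(\Gamma(x+a))^{1/x}}$, with domain $x\in(-a,\infty)$ if $a\le 0$ and $x\in(-a,\infty)\setminus\{0\}$ if $a>0$, where in addition $g_1(0)=e^{\gamma}$ if $a=1$ and $g_1(0)=e^{\gamma-1}$ if $a=2$. (1) (i) There is a point $x_0\in(-a,\infty)$ satisfying $x_0\psi(x_0+a)=\log\Gamma(x_0+a)$ such that $g_1$ is strictly increasing on $(-a,x_0)$ and strictly decreasing on $(x_0,\infty)$ if and only if $a\le 0$. (ii) There are points $x_1,x_2\in(-a,\infty)$ with $x_1<0<x_2$, satisfying $x_i\psi(x_i+a)=\log\Gamma(x_i+a)$ for $i=1,2$, such that $g_1$ is strictly decreasing on $(-a,x_1)$ and on $(x_2,\infty)$, and strictly increasing on $(x_1,0)$ and on $(0,x_2)$, if and only if $0<a<1$ or $a>2$. (iii) $g_1$ is strictly decreasing on $(-a,0)$ and on $(0,\infty)$ if and only if $1\le a\le 2$. (2) $g_1$ is strictly logarithmically completely monotonic on $(0,\infty)$ if and only if $1\le a\le 2$; and $g_1$ is strictly logarithmically completely monotonic on $(-a,\infty)$ if and only if $a=1$ or $a=2$.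
   Context: $\Gamma$ is the gamma function on $(0,\infty)$, $\psi=\Gamma'/\Gamma$ is the digamma function, and $\gamma=\lim_{n\to\infty}\left(\sum_{k=1}^n \frac1k-\log n\right)$ is the Euler–Mascheroni constant. For $a>0$ with $a\ne 1,2$, the function $g_1$ is not defined at $0$. A function $f$ with positive values is called logarithmically completely monotonic (LCM) on an interval $I\subset\mathbb{R}$ if $(-1)^n(\log f(x))^{(n)}\ge 0$ for all $x\in I$ and all $n=1,2,\dots$; it is strictly LCM on $I$ if these inequalities are all strict. Being monotone or LCM on a set includes being defined on that set. *)

(* Defs.v *)
From Stdlib Require Import Reals.
From Coquelicot Require Import Coquelicot.
Open Scope R_scope.

(* Meaningful for 0 < x, where the improper integral converges. *)
Definition Gamma (x : R) : R :=
  RInt_gen (fun t : R => Rpower t (x - 1) * exp (- t))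
    (at_right 0) (Rbar_locally p_infty).

Definition digamma (x : R) : R := Derive Gamma x / Gamma x.

Definition euler_gamma : R :=
  real (Lim_seq (fun n : nat => sum_n_m (fun k : nat => / INR k) 1 n - ln (INR n))).

(* Partial real functions: the values of [pval] outside [pdom] are junk.  The
   predicates below demand that the set they speak about be included in [pdom]. *)
Record pfun : Type := PFun { pdom : R -> Prop; pval :> R -> R }.

Definition open_itv (l r : Rbar) (x : R) : Prop := Rbar_lt l x /\ Rbar_lt x r.

Definition strictly_increasing_on (f : pfun) (D : R -> Prop) : Prop :=
  (forall x : R, D x -> pdom f x) /\
  (forall x y : R, D x -> D y -> x < y -> f x < f y).

Definition strictly_decreasing_on (f : pfun) (D : R -> Prop) : Prop :=
  (forall x : R, D x -> pdom f x) /\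
  (forall x y : R, D x -> D y -> x < y -> f y < f x).

(* Strict logarithmic complete monotonicity, for an open interval [D]:
   [Derive_n] is a two-sided derivative of the total function underlying [f], so
   the notion depends only on the values of [f] on [D] because [D] is open.
   [Derive_n] being total, the existence of every derivative is explicit. *)
Definition strictly_LCM_on (f : pfun) (D : R -> Prop) : Prop :=
  (forall x : R, D x -> pdom f x /\ 0 < f x) /\
  (forall (n : nat) (x : R), (1 <= n)%nat -> D x ->
     ex_derive_n (fun y : R => ln (f y)) n x /\
     0 < (-1) ^ n * Derive_n (fun y : R => ln (f y)) n x).

(* For a <= 0 the point 0 does not belong to (-a, +oo).  For 0 < a it belongs to
   the domain only if a = 1 or a = 2; the value 0 in the last branch is junk. *)
Definition g1 (a : R) : pfun :=
  PFun
    (fun x : R => - a < x /\ (a <= 0 \/ x <> 0 \/ a = 1 \/ a = 2))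
    (fun x : R =>
       if Req_EM_T x 0 then
         if Req_EM_T a 1 then exp euler_gamma
         else if Req_EM_T a 2 then exp (euler_gamma - 1)
         else 0
       else 1 / Rpower (Gamma (x + a)) (1 / x)).

(* Main.v *)
Require Import Defs.
From Stdlib Require Import Reals Lra Lia Factorial.
From Coquelicot Require Import Coquelicot.

(** Write L for ln Gamma and psi = L'.  Since ln g1(x) = - L(x+a)/x for x <> 0,
    its derivative is - F(x)/x^2 with F(x) = x psi(x+a) - L(x+a) ([slope_num]),
    and F'(x) = x psi'(x+a).  As psi' > 0, F decreases on (-a,0) and increases on
    (0,oo), so the sign of F is governed by its values at the two ends and at 0:
    - F becomes positive at infinity, because psi'(t) >= 1/t;
    - near -a, F(x) is a/t + ln t up to a bounded term, with t = x+a, hence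
      positive for a > 0 and negative for a <= 0;
    - F(0) = - L(a), and L, being strictly convex with L(1) = L(2) = 0, is at most
      0 on [1,2] and positive outside.
    The three monotonicity patterns of part (1) follow.  They exclude one another,
    since g1 cannot increase and decrease on a common interval, or be monotone
    where it is undefined; this gives the converse implications.

    For part (2), the identity L(x+a) = L(a) + x K(x) with
    K(x) = int_0^1 psi(a+sx) ds gives ln g1 = - L(a)/x - K on (0,oo).  Here
    K^(n)(x) = int_0^1 s^n psi^(n)(a+sx) ds has the sign of psi^(n), namely
    (-1)^(n+1) for n >= 1, and - L(a)/x contributes with the right sign exactly when
    L(a) <= 0.  If a is 1 or 2, then L(a) = 0 and ln g1 = - K on all of (-a,oo),
    the value at 0 being - psi(a).  Conversely, the inequality of order 1 says
    F > 0 off 0.  On (0,oo) this leaves only 1 <= a <= 2; on (-a,oo) it excludes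
    a <= 0, and for a > 0 the point 0 is in the domain of g1 only if a is 1 or 2.

    The properties of L come from Gauss' limit
      L(x) = lim (x ln(n+1) + ln n! - sum_(k<=n) ln(x+k)),
    obtained ([lim_gauss_log_0]) from the functional equation and Wendel's
    inequality Gamma(z+s) <= z^s Gamma(z), 0 <= s <= 1 ([Gamma_wendel]).  The
    derivatives of the approximants converge pointwise and are locally bounded,
    which suffices to differentiate the limit term by term
    ([is_derive_lim_seq]); so the integral defining Gamma is never differentiated,
    and the signs of the derivatives of psi and the value psi(1) = - gamma can be
    read off the approximants. *)

Open Scope R_scope.

(** * Elementary real analysis *)

Lemma exp_le a b : a <= b -> exp a <= exp b.
Proof. intros [H | ->]; [left; now apply exp_increasing | lra]. Qed.

Lemma ln_le_sub_1 u : 0 < u -> ln u <= u - 1.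
Proof. intros Hu. pose proof (exp_ineq1_le (ln u)). rewrite exp_ln in H; lra. Qed.

Lemma INR_S_ge_1 n : 1 <= INR (S n).
Proof. rewrite S_INR. pose proof (pos_INR n). lra. Qed.

Lemma inv_INR_S_bounds n : 0 < / INR (S n) <= INR (S n).
Proof.
  pose proof (INR_S_ge_1 n). split.
  - apply Rinv_0_lt_compat. lra.
  - apply Rle_trans with 1; auto. rewrite <- Rinv_1. apply Rinv_le_contravar; lra.
Qed.

Lemma lim_inv_INR_S : is_lim_seq (fun n => / INR (S n)) 0.
Proof.
  apply (is_lim_seq_incr_1 (fun n => / INR n)).
  apply (is_lim_seq_inv INR p_infty); [apply is_lim_seq_INR | discriminate].
Qed.

Lemma lim_INR_S : is_lim_seq (fun n => INR (S n)) p_infty.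
Proof. apply (is_lim_seq_incr_1 INR). apply is_lim_seq_INR. Qed.

Lemma sum_n_S (f : nat -> R) n : sum_n f (S n) = sum_n f n + f (S n).
Proof. apply (sum_Sn f n). Qed.

Lemma sum_n_scal (c : R) (f : nat -> R) n :
  sum_n (fun k => c * f k) n = c * sum_n f n.
Proof. apply (sum_n_mult_l c f n). Qed.

Lemma sum_n_add (f g : nat -> R) n :
  sum_n (fun k => f k + g k) n = sum_n f n + sum_n g n.
Proof. apply (sum_n_plus f g n). Qed.

Lemma mean_value (f f' : R -> R) (x y : R) : x < y ->
  (forall z, x <= z <= y -> is_derive f z (f' z)) ->
  exists c, x < c < y /\ f y - f x = f' c * (y - x).
Proof.
  intros Hxy H. destruct (MVT_cor2 f f' x y Hxy) as (c & E & Hc).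
  - intros z Hz. apply is_derive_Reals. now apply H.
  - now exists c.
Qed.

Lemma zero_between (f f' : R -> R) (x y : R) : x < y ->
  (forall z, x <= z <= y -> is_derive f z (f' z)) ->
  f x < 0 < f y \/ f y < 0 < f x ->
  exists c, x < c < y /\ f c = 0.
Proof.
  intros Hxy H Hs.
  assert (Hc : forall z, x <= z <= y -> continuity_pt f z).
  { intros z Hz. apply derivable_continuous_pt. exists (f' z).
    apply is_derive_Reals. now apply H. }
  assert (Hz : exists z, x <= z <= y /\ f z = 0).
  { destruct Hs as [Hs | Hs].
    - destruct (Ranalysis5.IVT_interv f x y Hc Hxy) as [z Hz]; try lra. now exists z.
    - destruct (Ranalysis5.IVT_interv (fun t => - f t) x y) as [z [Hz Ez]]; try lra.
      + intros t Ht. apply continuity_pt_opp. now apply Hc.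
      + exists z. split; auto. lra. }
  destruct Hz as [z [[H1 H2] Hz]]. exists z. split; auto.
  destruct H1 as [H1 | <-]; [|lra]. destruct H2 as [H2 | ->]; [|lra]. auto.
Qed.

Lemma taylor2_bound (f f' f'' : R -> R) (M r x y : R) :
  (forall z, Rabs (z - x) < r ->
     is_derive f z (f' z) /\ is_derive f' z (f'' z) /\ Rabs (f'' z) <= M) ->
  Rabs (y - x) < r ->
  Rabs (f y - f x - (y - x) * f' x) <= M * (y - x) ^ 2.
Proof.
  intros H Hy.
  assert (Hbet : forall b z, Rabs (b - x) < r -> Rmin x b <= z <= Rmax x b ->
            Rabs (z - x) <= Rabs (b - x)).
  { intros b z Hb. unfold Rmin, Rmax, Rabs.
    destruct (Rle_dec x b); repeat destruct Rcase_abs; lra. }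
  assert (Hcont : forall g g' b, Rabs (b - x) < r ->
     (forall z, Rabs (z - x) < r -> is_derive g z (g' z)) ->
     exists c, Rabs (c - x) <= Rabs (b - x) /\ g b - g x = g' c * (b - x)).
  { intros g g' b Hb Hg. destruct (MVT_gen g x b g') as (c & Hc & E).
    - intros z Hz. apply Hg. apply Rle_lt_trans with (2 := Hb). apply Hbet; auto; lra.
    - intros z Hz. apply derivable_continuous_pt. exists (g' z). apply is_derive_Reals.
      apply Hg. apply Rle_lt_trans with (2 := Hb). now apply Hbet.
    - exists c. split; auto. }
  destruct (Hcont f f' y Hy) as (c & Hc & E1). { intros z Hz; now apply H. }
  destruct (Hcont f' f'' c) as (d & Hd & E2); [lra | |]. { intros z Hz; now apply H. }
  replace (f y - f x - (y - x) * f' x) with (f'' d * ((c - x) * (y - x))).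
  2: { rewrite E1. replace (f' c) with (f' x + f'' d * (c - x)) by lra. ring. }
  rewrite !Rabs_mult.
  assert (Hd2 : Rabs (f'' d) <= M) by (apply H; lra).
  rewrite <- (pow2_abs (y - x)). simpl. rewrite Rmult_1_r.
  apply Rmult_le_compat; auto using Rabs_pos.
  - apply Rmult_le_pos; apply Rabs_pos.
  - apply Rmult_le_compat_r; auto using Rabs_pos.
Qed.

(** Letting n tend to infinity in Taylor's inequality
    |f_n y - f_n x - (y-x) f_n' x| <= M (y-x)^2 bounds the increments of the limit
    in the same way.  A uniform local bound on the second derivatives thus takes
    the place of uniform convergence of the first ones. *)
Lemma is_derive_lim_seq (f f' f'' : nat -> R -> R) (F : R -> R) (G M r x : R) :
  0 < r ->
  (forall n y, Rabs (y - x) < r ->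
     is_derive (f n) y (f' n y) /\ is_derive (f' n) y (f'' n y) /\ Rabs (f'' n y) <= M) ->
  (forall y, Rabs (y - x) < r -> is_lim_seq (fun n => f n y) (F y)) ->
  is_lim_seq (fun n => f' n x) G ->
  is_derive F x G.
Proof.
  intros Hr H HF HG.
  assert (Hx : Rabs (x - x) < r) by (rewrite Rminus_diag, Rabs_R0; auto).
  assert (HM : 0 <= M).
  { destruct (H O x Hx) as (_ & _ & HM). pose proof (Rabs_pos (f'' O x)). lra. }
  assert (HT : forall y, Rabs (y - x) < r ->
     Rabs (F y - F x - (y - x) * G) <= M * (y - x) ^ 2).
  { intros y Hy.
    apply (is_lim_seq_le (fun n => Rabs (f n y - f n x - (y - x) * f' n x))
             (fun _ => M * (y - x) ^ 2) (Rabs (F y - F x - (y - x) * G)) (M * (y - x) ^ 2)).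
    - intros n. exact (taylor2_bound (f n) (f' n) (f'' n) M r x y (H n) Hy).
    - apply (is_lim_seq_abs _ (F y - F x - (y - x) * G)).
      apply is_lim_seq_minus'; [apply is_lim_seq_minus'|]; auto.
      apply (is_lim_seq_scal_l (fun n => f' n x) (y - x) G). exact HG.
    - apply is_lim_seq_const. }
  apply is_derive_Reals. intros eps Heps.
  assert (Hd : 0 < Rmin r (eps / (M + 1))).
  { apply Rmin_glb_lt; auto. apply Rdiv_lt_0_compat; lra. }
  exists (mkposreal _ Hd). simpl. intros h Hh0 Hh.
  assert (Hh1 : Rabs h < r) by (apply Rlt_le_trans with (1 := Hh), Rmin_l).
  assert (Hh2 : Rabs h < eps / (M + 1)) by (apply Rlt_le_trans with (1 := Hh), Rmin_r).
  assert (HTh := HT (x + h)). replace (x + h - x) with h in HTh by ring.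
  specialize (HTh Hh1).
  replace ((F (x + h) - F x) / h - G) with ((F (x + h) - F x - h * G) / h) by (field; auto).
  unfold Rdiv. rewrite Rabs_mult, Rabs_inv.
  assert (Hp : 0 < Rabs h) by now apply Rabs_pos_lt.
  apply Rlt_div_l; auto.
  apply Rlt_div_r in Hh2; [|lra].
  rewrite <- (pow2_abs h) in HTh. nra.
Qed.

(** On an open set, exhibiting a chain of successive derivatives identifies all the
    iterated derivatives. *)
Lemma Derive_n_family (f : R -> R) (G : nat -> R -> R) (D : R -> Prop) : open D ->
  (forall x, D x -> f x = G O x) ->
  (forall n x, D x -> is_derive (G n) x (G (S n) x)) ->
  forall n x, D x -> ex_derive_n f n x /\ Derive_n f n x = G n x.
Proof.
  intros HD H0 HG.
  assert (E : forall n x, D x -> Derive_n f n x = G n x).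
  { induction n as [|n IH]; intros x Hx; [now apply H0|].
    simpl. apply is_derive_unique. apply is_derive_ext_loc with (G n); auto.
    apply filter_imp with (2 := HD x Hx). intros y Hy. symmetry. now apply IH. }
  intros n x Hx. split; auto.
  destruct n as [|n]; simpl; auto.
  exists (G (S n) x). apply is_derive_ext_loc with (G n); auto.
  apply filter_imp with (2 := HD x Hx). intros y Hy. symmetry. now apply E.
Qed.

(** * Improper integrals over the positive half-line *)

Lemma ex_RInt_pos (f : R -> R) (a b : R) :
  (forall t, 0 < t -> continuous f t) -> 0 < a -> 0 < b -> ex_RInt f a b.
Proof.
  intros Hc Ha Hb. apply (ex_RInt_continuous f). intros z [Hz _]. apply Hc.
  apply Rlt_le_trans with (2 := Hz). now apply Rmin_glb_lt.
Qed.

Lemma RInt_widen (f : R -> R) (a a' b' b : R) :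
  (forall t, 0 < t -> continuous f t) -> (forall t, 0 < t -> 0 <= f t) ->
  0 < a -> a <= a' -> a' <= b' -> b' <= b -> RInt f a' b' <= RInt f a b.
Proof.
  intros Hc Hp Ha H1 H2 H3.
  assert (E1 : ex_RInt f a a') by (apply ex_RInt_pos; auto; lra).
  assert (E2 : ex_RInt f a' b') by (apply ex_RInt_pos; auto; lra).
  assert (E3 : ex_RInt f b' b) by (apply ex_RInt_pos; auto; lra).
  rewrite <- (RInt_Chasles f a a' b), <- (RInt_Chasles f a' b' b); auto.
  2: now apply ex_RInt_Chasles with b'.
  assert (0 <= RInt f a a') by (apply RInt_ge_0; auto; intros; apply Hp; lra).
  assert (0 <= RInt f b' b) by (apply RInt_ge_0; auto; intros; apply Hp; lra).
  unfold plus; simpl; lra.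
Qed.

(** The integral of a nonnegative function grows with the interval, so its
    supremum over all intervals is its limit. *)
Lemma ex_RInt_gen_bounded (f : R -> R) (M : R) :
  (forall t, 0 < t -> continuous f t) -> (forall t, 0 < t -> 0 <= f t) ->
  (forall a b, 0 < a -> a <= b -> RInt f a b <= M) ->
  exists l, is_RInt_gen f (at_right 0) (Rbar_locally p_infty) l.
Proof.
  intros Hc Hp Hb.
  destruct (completeness (fun r => exists a b, 0 < a /\ a <= b /\ r = RInt f a b))
    as [l [Hub Hlub]].
  - exists M. intros r (a & b & H1 & H2 & ->). auto.
  - exists (RInt f 1 1), 1, 1. repeat split; lra.
  - exists l. unfold is_RInt_gen.
    apply filterlimi_lim_ext_loc with (f := fun ab => RInt f (fst ab) (snd ab)).
    + apply Filter_prod with (fun a => 0 < a) (fun b => 0 < b).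
      * exists (mkposreal 1 Rlt_0_1). intros y _ Hy. exact Hy.
      * exists 0. auto.
      * intros a b Ha Hb'. simpl. apply (RInt_correct f). apply ex_RInt_pos; auto.
    + apply filterlim_locally. intros eps.
      assert (Hex : exists a b, 0 < a /\ a <= b /\ l - eps < RInt f a b).
      { apply Classical_Prop.NNPP. intros Hn.
        assert (l <= l - eps).
        { apply Hlub. intros r (a & b & H1 & H2 & ->).
          apply Rnot_lt_le. intros H. apply Hn. exists a, b. auto. }
        pose proof (cond_pos eps). lra. }
      destruct Hex as (a0 & b0 & H1 & H2 & H3).
      apply Filter_prod with (fun a => 0 < a < a0) (fun b => b0 < b).
      * exists (mkposreal a0 H1). intros y Hy Hy0. split; auto.
        unfold ball in Hy; simpl in Hy; unfold AbsRing_ball, abs, minus, plus, opp in Hy;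
          simpl in Hy. rewrite Ropp_0, Rplus_0_r in Hy.
        rewrite Rabs_pos_eq in Hy; lra.
      * exists b0. auto.
      * intros a b Ha Hb'. simpl.
        assert (RInt f a0 b0 <= RInt f a b) by (apply RInt_widen; auto; lra).
        assert (RInt f a b <= l).
        { apply Hub. exists a, b. repeat split; lra. }
        unfold ball; simpl; unfold AbsRing_ball, abs, minus, plus, opp; simpl.
        apply Rabs_def1; lra.
Qed.

Lemma RInt_gen_seq (f : R -> R) (l : R) :
  is_RInt_gen f (at_right 0) (Rbar_locally p_infty) l ->
  is_lim_seq (fun n => RInt f (/ INR (S n)) (INR (S n))) l.
Proof.
  intros H.
  assert (L1 : filterlim (fun n => / INR (S n)) eventually (at_right 0)).
  { intros P [eps HP].
    destruct (lim_inv_INR_S (ball 0 eps)) as [N HN]. { now exists eps. }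
    exists N. intros n Hn. apply HP. now apply HN.
    apply Rinv_0_lt_compat, lt_0_INR. lia. }
  assert (L := filterlimi_comp_2 (fun n => / INR (S n)) (fun n => INR (S n))
                 (is_RInt f) L1 lim_INR_S H).
  intros P HP. destruct (L P HP) as [N HN].
  exists N. intros n Hn. destruct (HN n Hn) as (z & Hz & Pz).
  now rewrite (is_RInt_unique f _ _ z Hz).
Qed.

(** * The Gamma integral *)

Definition gamma_integrand (x t : R) : R := Rpower t (x - 1) * exp (- t).

Lemma gamma_integrand_pos x t : 0 < gamma_integrand x t.
Proof. apply Rmult_lt_0_compat; apply exp_pos. Qed.

Lemma gamma_integrand_continuous x t : 0 < t -> continuous (gamma_integrand x) t.
Proof.
  intros Ht. apply (ex_derive_continuous (gamma_integrand x)).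
  unfold gamma_integrand, Rpower. auto_derive. lra.
Qed.

Lemma Rpower_mul_exp_neg_le p t : 0 < p -> 0 < t ->
  Rpower t p * exp (- t) <= exp (p * ln p - p).
Proof.
  intros Hp Ht. unfold Rpower. rewrite <- exp_plus. apply exp_le.
  assert (H := ln_le_sub_1 (t / p) (Rdiv_lt_0_compat _ _ Ht Hp)).
  rewrite ln_div in H by auto.
  apply Rmult_le_compat_l with (r := p) in H; [|lra].
  replace (p * (t / p - 1)) with (t - p) in H by (field; lra). lra.
Qed.

(** The integrand is at most a constant times the derivative of - 1/(1+t^x), a
    bounded function.  This single comparison works at 0, where both behave like
    t^(x-1), and at infinity, where e^(-t) absorbs (1+t^x)^2. *)
Lemma RInt_gamma_integrand_bounded x : 0 < x ->
  exists M, forall a b, 0 < a -> a <= b -> RInt (gamma_integrand x) a b <= M.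
Proof.
  intros Hx.
  set (C := exp (2 * x * ln (2 * x) - 2 * x)).
  set (K := (2 + 2 * C) / x).
  assert (HC : 0 < C) by apply exp_pos.
  assert (HK : 0 < K) by (apply Rdiv_lt_0_compat; lra).
  set (G := fun t => - K / (1 + exp (x * ln t))).
  set (dG := fun t => K * (x * / t * exp (x * ln t)) / (1 + exp (x * ln t)) ^ 2).
  exists K. intros a b Ha Hab.
  assert (HI : is_RInt dG a b (G b - G a)).
  { apply (is_RInt_derive G dG).
    - intros t [Ht _]. rewrite Rmin_left in Ht by auto.
      pose proof (exp_pos (x * ln t)).
      unfold G, dG. auto_derive; [split; lra|]. field. split; lra.
    - intros t [Ht _]. rewrite Rmin_left in Ht by auto.
      pose proof (exp_pos (x * ln t)).
      apply (ex_derive_continuous dG). unfold dG. auto_derive.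
      repeat split; try lra. apply Rgt_not_eq, Rmult_lt_0_compat; lra. }
  apply Rle_trans with (RInt dG a b).
  - apply RInt_le; auto.
    + apply ex_RInt_pos; try lra. apply gamma_integrand_continuous.
    + eexists; apply HI.
    + intros t [Ht _]. assert (0 < t) by lra.
      unfold gamma_integrand, dG, Rpower.
      replace ((x - 1) * ln t) with (x * ln t + - ln t) by ring.
      rewrite exp_plus, exp_Ropp, exp_ln by auto.
      pose proof (Rpower_mul_exp_neg_le (2 * x) t ltac:(lra) H) as HB. fold C in HB.
      unfold Rpower in HB. replace (2 * x * ln t) with (x * ln t + x * ln t) in HB by ring.
      rewrite exp_plus in HB.
      pose proof (exp_pos (x * ln t)) as Hw. set (w := exp (x * ln t)) in *.
      assert (He1 : exp (- t) <= 1) by (rewrite <- exp_0; apply exp_le; lra).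
      pose proof (exp_pos (- t)) as He. set (e := exp (- t)) in *.
      (* with w = t^x and e = e^(-t), the claim reads e (1+w)^2 <= 2 + 2 C;
         it follows from (1+w)^2 <= 2 + 2 w^2 and e w^2 <= C *)
      replace (K * (x * / t * w) / (1 + w) ^ 2) with (w * / t * ((2 + 2 * C) / (1 + w) ^ 2)).
      2: { unfold K. field. lra. }
      apply Rmult_le_compat_l.
      { left. apply Rmult_lt_0_compat; auto. now apply Rinv_0_lt_compat. }
      apply Rle_div_r. { apply pow_lt. lra. }
      assert (0 <= e * (1 - w) ^ 2).
      { apply Rmult_le_pos; [lra| apply pow2_ge_0]. }
      nra.
  - rewrite (is_RInt_unique dG _ _ _ HI). unfold G.
    assert (0 < K / (1 + exp (x * ln b))).
    { pose proof (exp_pos (x * ln b)). apply Rdiv_lt_0_compat; lra. }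
    assert (K / (1 + exp (x * ln a)) <= K).
    { pose proof (exp_pos (x * ln a)). apply Rle_div_l; nra. }
    unfold Rdiv in *. lra.
Qed.

Lemma ex_Gamma x : 0 < x ->
  exists l, is_RInt_gen (gamma_integrand x) (at_right 0) (Rbar_locally p_infty) l.
Proof.
  intros Hx. destruct (RInt_gamma_integrand_bounded x Hx) as [M HM].
  apply (ex_RInt_gen_bounded (gamma_integrand x) M); auto.
  - apply gamma_integrand_continuous.
  - intros t _. apply Rlt_le, gamma_integrand_pos.
Qed.

Definition truncated_gamma (x : R) (n : nat) : R :=
  RInt (gamma_integrand x) (/ INR (S n)) (INR (S n)).

(** Truncating symmetrically at 1/(n+1) and n+1 reduces every statement on the
    two-sided improper integral to the limit of one sequence. *)
Lemma truncated_gamma_lim x : 0 < x -> is_lim_seq (truncated_gamma x) (Gamma x).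
Proof.
  intros Hx. destruct (ex_Gamma x Hx) as [l Hl].
  change (is_lim_seq (truncated_gamma x)
    (RInt_gen (gamma_integrand x) (at_right 0) (Rbar_locally p_infty))).
  rewrite (is_RInt_gen_unique _ _ Hl). now apply RInt_gen_seq.
Qed.

Lemma ex_RInt_gamma_integrand x n : ex_RInt (gamma_integrand x) (/ INR (S n)) (INR (S n)).
Proof.
  pose proof (inv_INR_S_bounds n). apply ex_RInt_pos; try lra. apply gamma_integrand_continuous.
Qed.

Lemma Gamma_pos x : 0 < x -> 0 < Gamma x.
Proof.
  intros Hx.
  apply Rlt_le_trans with (RInt (gamma_integrand x) 1 2).
  - apply RInt_gt_0; try lra.
    + intros; apply gamma_integrand_pos.
    + intros t Ht. apply gamma_integrand_continuous. lra.
  - assert (L := truncated_gamma_lim x Hx). apply is_lim_seq_incr_1 in L.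
    apply (is_lim_seq_le (fun _ => RInt (gamma_integrand x) 1 2) (fun n => truncated_gamma x (S n))
             (RInt (gamma_integrand x) 1 2) (Gamma x)); auto using is_lim_seq_const.
    intros n. pose proof (INR_S_ge_1 n). assert (2 <= INR (S (S n))) by (rewrite S_INR; lra).
    apply RInt_widen; try lra.
    + apply gamma_integrand_continuous.
    + intros; apply Rlt_le, gamma_integrand_pos.
    + apply Rinv_0_lt_compat; lra.
    + rewrite <- Rinv_1. apply Rinv_le_contravar; lra.
Qed.

(** Integration by parts of the derivative of t^x e^(-t). *)
Lemma truncated_gamma_succ x n : 0 < x ->
  truncated_gamma (x + 1) n = x * truncated_gamma x n
    + (Rpower (/ INR (S n)) x * exp (- / INR (S n))
       - Rpower (INR (S n)) x * exp (- INR (S n))).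
Proof.
  intros Hx. unfold truncated_gamma.
  pose proof (inv_INR_S_bounds n) as Hb.
  set (a := / INR (S n)) in *. set (b := INR (S n)) in *.
  assert (HI : is_RInt (fun t => x * gamma_integrand x t - gamma_integrand (x + 1) t) a b
     (Rpower b x * exp (- b) - Rpower a x * exp (- a))).
  { apply (is_RInt_derive (fun t => Rpower t x * exp (- t))).
    - intros t [Ht _]. rewrite Rmin_left in Ht by apply Hb.
      unfold gamma_integrand, Rpower. auto_derive; [lra|].
      replace (x + 1 - 1) with x by ring.
      replace ((x - 1) * ln t) with (x * ln t + - ln t) by ring.
      rewrite exp_plus, (exp_Ropp (ln t)), exp_ln by lra. field. lra.
    - intros t [Ht _]. rewrite Rmin_left in Ht by apply Hb.
      apply (ex_derive_continuous (fun t => x * gamma_integrand x t - gamma_integrand (x + 1) t)).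
      unfold gamma_integrand, Rpower. auto_derive. lra. }
  apply (is_RInt_unique (fun t => x * gamma_integrand x t - gamma_integrand (x + 1) t)) in HI.
  rewrite (RInt_minus (fun t => x * gamma_integrand x t) (gamma_integrand (x + 1))) in HI.
  - rewrite (RInt_scal (gamma_integrand x)) in HI by apply ex_RInt_gamma_integrand.
    unfold minus, plus, opp, scal in HI; simpl in HI; unfold mult in HI; simpl in HI. lra.
  - apply (ex_RInt_scal (gamma_integrand x)). apply ex_RInt_gamma_integrand.
  - apply ex_RInt_gamma_integrand.
Qed.

Lemma Gamma_succ x : 0 < x -> Gamma (x + 1) = x * Gamma x.
Proof.
  intros Hx.
  assert (L : is_lim_seq (truncated_gamma (x + 1)) (x * Gamma x + (0 - 0))).
  { apply is_lim_seq_ext with (1 := fun n => eq_sym (truncated_gamma_succ x n Hx)).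
    apply is_lim_seq_plus'.
    - apply (is_lim_seq_scal_l (truncated_gamma x) x (Gamma x)). now apply truncated_gamma_lim.
    - apply is_lim_seq_minus'.
      + apply is_lim_seq_le_le with (u := fun _ => 0)
           (w := fun n => exp (- (x * ln (INR (S n))))).
        * intros n. pose proof (inv_INR_S_bounds n). pose proof (INR_S_ge_1 n).
          unfold Rpower. rewrite ln_Rinv by lra.
          replace (x * - ln (INR (S n))) with (- (x * ln (INR (S n)))) by ring.
          pose proof (exp_pos (- (x * ln (INR (S n))))).
          pose proof (exp_pos (- / INR (S n))).
          assert (exp (- / INR (S n)) <= 1) by (rewrite <- exp_0; apply exp_le; lra).
          split; nra.
        * apply is_lim_seq_const.
        * apply (is_lim_comp_seq exp (fun n => - (x * ln (INR (S n)))) m_infty 0).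
          -- apply is_lim_exp_m.
          -- exists O. discriminate.
          -- apply (is_lim_seq_opp _ p_infty).
             replace p_infty with (Rbar_mult x p_infty).
             2: { simpl. destruct (Rle_dec 0 x); try lra.
                  destruct (Rle_lt_or_eq_dec 0 x r); auto. lra. }
             apply is_lim_seq_scal_l.
             apply (is_lim_comp_seq ln (fun n => INR (S n)) p_infty p_infty).
             ++ apply is_lim_ln_p.
             ++ exists O. discriminate.
             ++ apply lim_INR_S.
      + apply is_lim_seq_le_le with (u := fun _ => 0)
           (w := fun n => exp ((x + 1) * ln (x + 1) - (x + 1)) * / INR (S n)).
        * intros n. pose proof (INR_S_ge_1 n).
          pose proof (exp_pos (x * ln (INR (S n)))).
          pose proof (exp_pos (- INR (S n))).
          pose proof (Rpower_mul_exp_neg_le (x + 1) (INR (S n)) ltac:(lra) ltac:(lra)).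
          rewrite Rpower_plus, Rpower_1 in H2 by lra. unfold Rpower in *.
          split; [nra|]. apply (Rle_div_r _ _ (INR (S n))); lra.
        * apply is_lim_seq_const.
        * replace (Finite 0) with (Rbar_mult (exp ((x + 1) * ln (x + 1) - (x + 1))) 0)
            by (simpl; now rewrite Rmult_0_r).
          apply is_lim_seq_scal_l. apply lim_inv_INR_S. }
  pose proof (truncated_gamma_lim (x + 1) ltac:(lra)) as L2.
  apply is_lim_seq_unique in L. apply is_lim_seq_unique in L2.
  rewrite L2 in L. injection L. lra.
Qed.

Lemma Gamma_1 : Gamma 1 = 1.
Proof.
  pose proof (truncated_gamma_lim 1 Rlt_0_1) as L2.
  assert (L : is_lim_seq (truncated_gamma 1) (1 - 0)).
  { apply is_lim_seq_ext with (fun n => exp (- / INR (S n)) - exp (- INR (S n))).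
    - intros n. unfold truncated_gamma. symmetry. apply is_RInt_unique.
      pose proof (inv_INR_S_bounds n) as Hb.
      replace (exp (- / INR (S n)) - exp (- INR (S n)))
        with (- exp (- INR (S n)) - - exp (- / INR (S n))) by ring.
      apply (is_RInt_derive (fun t => - exp (- t))).
      + intros t [Ht _]. rewrite Rmin_left in Ht by apply Hb.
        unfold gamma_integrand. rewrite Rminus_diag, Rpower_O by lra. auto_derive; auto. ring.
      + intros t [Ht _]. rewrite Rmin_left in Ht by apply Hb. apply gamma_integrand_continuous. lra.
    - apply is_lim_seq_minus'.
      + rewrite <- exp_0. apply is_lim_seq_continuous.
        { apply derivable_continuous, derivable_exp. }
        rewrite <- Ropp_0. apply (is_lim_seq_opp _ 0). apply lim_inv_INR_S.
      + apply (is_lim_comp_seq exp (fun n => - INR (S n)) m_infty 0).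
        * apply is_lim_exp_m.
        * exists O. discriminate.
        * apply (is_lim_seq_opp _ p_infty). apply lim_INR_S. }
  apply is_lim_seq_unique in L. apply is_lim_seq_unique in L2.
  rewrite L2 in L. injection L. lra.
Qed.

(** Bernoulli's inequality for exponents in [0,1]: u^s lies below its tangent at
    u = 1, by convexity of exp. *)
Lemma Rpower_le_affine u s : 0 < u -> 0 <= s <= 1 -> Rpower u s <= 1 + s * (u - 1).
Proof.
  intros Hu Hs. unfold Rpower. set (l := ln u).
  replace u with (exp l) by (now apply exp_ln).
  pose proof (exp_ineq1_le (l - s * l)) as H1.
  pose proof (exp_ineq1_le (- (s * l))) as H2.
  pose proof (exp_pos (s * l)) as Hm.
  apply Rmult_le_compat_l with (r := exp (s * l)) in H1; [|lra].
  apply Rmult_le_compat_l with (r := exp (s * l)) in H2; [|lra].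
  rewrite <- exp_plus in H1, H2.
  replace (s * l + (l - s * l)) with l in H1 by ring.
  rewrite Rplus_opp_r, exp_0 in H2.
  apply Rmult_le_compat_l with (r := s) in H1; [|lra].
  apply Rmult_le_compat_l with (r := 1 - s) in H2; [|lra].
  nra.
Qed.

(** Integrate the tangent bound t^s <= z^s (1 + s (t/z - 1)) against the weight of
    Gamma(z).  The linear term drops out because Gamma(z+1) = z Gamma(z), that is,
    the weight has mean z. *)
Lemma Gamma_wendel z s : 0 < z -> 0 <= s <= 1 -> Gamma (z + s) <= Rpower z s * Gamma z.
Proof.
  intros Hz Hs.
  assert (Hp := exp_pos (s * ln z)). fold (Rpower z s) in Hp.
  assert (E : Rpower z s * Gamma z
     = Rpower z s * (1 - s) * Gamma z + Rpower z s * s / z * Gamma (z + 1)).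
  { rewrite Gamma_succ by auto. field. lra. }
  rewrite E. clear E.
  apply (is_lim_seq_le (truncated_gamma (z + s)) (fun n =>
     Rpower z s * (1 - s) * truncated_gamma z n + Rpower z s * s / z * truncated_gamma (z + 1) n)
     (Gamma (z + s)) (Rpower z s * (1 - s) * Gamma z + Rpower z s * s / z * Gamma (z + 1))).
  - intros n. unfold truncated_gamma. pose proof (inv_INR_S_bounds n) as Hb.
    set (c := Rpower z s * (1 - s)). set (d := Rpower z s * s / z).
    assert (E : c * RInt (gamma_integrand z) (/ INR (S n)) (INR (S n))
       + d * RInt (gamma_integrand (z + 1)) (/ INR (S n)) (INR (S n))
       = RInt (fun t => c * gamma_integrand z t + d * gamma_integrand (z + 1) t)
           (/ INR (S n)) (INR (S n))).
    { rewrite (RInt_plus (fun t => c * gamma_integrand z t)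
                   (fun t => d * gamma_integrand (z + 1) t)).
      - rewrite (RInt_scal (gamma_integrand z)), (RInt_scal (gamma_integrand (z + 1)))
          by apply ex_RInt_gamma_integrand.
        reflexivity.
      - apply (ex_RInt_scal (gamma_integrand z)), ex_RInt_gamma_integrand.
      - apply (ex_RInt_scal (gamma_integrand (z + 1))), ex_RInt_gamma_integrand. }
    rewrite E. clear E.
    apply RInt_le.
    + apply Hb.
    + apply ex_RInt_gamma_integrand.
    + apply (ex_RInt_plus (fun t => c * gamma_integrand z t)
               (fun t => d * gamma_integrand (z + 1) t)).
      * apply (ex_RInt_scal (gamma_integrand z)), ex_RInt_gamma_integrand.
      * apply (ex_RInt_scal (gamma_integrand (z + 1))), ex_RInt_gamma_integrand.
    + intros t [Ht _]. assert (0 < t) by lra.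
      assert (E1 : gamma_integrand (z + s) t = Rpower z s * Rpower (t / z) s * gamma_integrand z t).
      { unfold gamma_integrand. replace (z + s - 1) with (s + (z - 1)) by ring.
        rewrite Rpower_plus, Rpower_mult_distr; auto.
        - replace (z * (t / z)) with t by (field; lra). ring.
        - now apply Rdiv_lt_0_compat. }
      assert (E2 : gamma_integrand (z + 1) t = t * gamma_integrand z t).
      { unfold gamma_integrand. replace (z + 1 - 1) with (1 + (z - 1)) by ring.
        rewrite Rpower_plus, Rpower_1 by auto. ring. }
      rewrite E1, E2. unfold c, d.
      replace (Rpower z s * (1 - s) * gamma_integrand z t
               + Rpower z s * s / z * (t * gamma_integrand z t))
        with (Rpower z s * (1 + s * (t / z - 1)) * gamma_integrand z t) by (field; lra).
      apply Rmult_le_compat_r; [left; apply gamma_integrand_pos|].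
      apply Rmult_le_compat_l; [lra|].
      apply Rpower_le_affine; auto. now apply Rdiv_lt_0_compat.
  - apply truncated_gamma_lim. lra.
  - apply is_lim_seq_plus'.
    + apply (is_lim_seq_scal_l (truncated_gamma z) _ (Gamma z)). now apply truncated_gamma_lim.
    + apply (is_lim_seq_scal_l (truncated_gamma (z + 1)) _ (Gamma (z + 1))).
      apply truncated_gamma_lim. lra.
Qed.

(** * Gauss' product and its logarithmic derivatives *)

(** The m-th derivative of - ln. *)
Definition neg_ln_der (m : nat) (t : R) : R :=
  match m with
  | O => - ln t
  | S p => (-1) ^ m * INR (fact p) / t ^ m
  end.

Lemma is_derive_neg_ln_der m t : 0 < t ->
  is_derive (neg_ln_der m) t (neg_ln_der (S m) t).
Proof.
  intros Ht. destruct m as [|m].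
  - unfold neg_ln_der. auto_derive; auto. simpl. field. lra.
  - unfold neg_ln_der.
    assert (t ^ m <> 0) by (apply pow_nonzero; lra).
    auto_derive. { change (t * t ^ m) with (t ^ S m). apply pow_nonzero; lra. }
    rewrite fact_simpl, mult_INR. destruct m; simpl; field; [lra|].
    split; [exact (pow_nonzero t m (Rgt_not_eq _ _ Ht)) | lra].
Qed.

Definition gauss_log_affine (m n : nat) (x : R) : R :=
  match m with
  | O => x * ln (INR (S n)) + ln (INR (fact n))
  | 1%nat => ln (INR (S n))
  | _ => 0
  end.

(** The m-th derivative of the logarithm of Gauss' approximation
    (n+1)^x n! / (x (x+1) ... (x+n)) to Gamma(x). *)
Definition gauss_log (m n : nat) (x : R) : R :=
  gauss_log_affine m n x + sum_n (fun k => neg_ln_der m (x + INR k)) n.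

Lemma is_derive_gauss_log m n x : 0 < x -> is_derive (gauss_log m n) x (gauss_log (S m) n x).
Proof.
  intros Hx. unfold gauss_log.
  apply (is_derive_plus (gauss_log_affine m n)).
  - destruct m as [|[|m]]; unfold gauss_log_affine; auto_derive; auto. apply Rmult_1_l.
  - apply (is_derive_sum_n (fun k y => neg_ln_der m (y + INR k))).
    intros k _. pose proof (pos_INR k).
    assert (D := is_derive_neg_ln_der m (x + INR k) ltac:(lra)).
    assert (D2 : is_derive (fun y => y + INR k) x 1) by (auto_derive; auto).
    apply (is_derive_comp (neg_ln_der m) (fun y => y + INR k) x _ _ D) in D2.
    unfold scal in D2; simpl in D2; unfold mult in D2; simpl in D2.
    now rewrite Rmult_1_l in D2.
Qed.

Definition hurwitz_sum (m n : nat) (x : R) : R := sum_n (fun k => / (x + INR k) ^ m) n.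

Lemma gauss_log_hurwitz_sum m n x :
  gauss_log (S (S m)) n x = (-1) ^ m * INR (fact (S m)) * hurwitz_sum (S (S m)) n x.
Proof.
  unfold gauss_log, hurwitz_sum, gauss_log_affine. rewrite Rplus_0_l.
  rewrite <- sum_n_scal.
  apply sum_n_ext. intros k. unfold neg_ln_der. simpl. unfold Rdiv. ring.
Qed.

Lemma gauss_log_1 n x : gauss_log 1 n x = ln (INR (S n)) - hurwitz_sum 1 n x.
Proof.
  unfold gauss_log, hurwitz_sum, gauss_log_affine, Rminus. f_equal.
  replace (- sum_n (fun k => / (x + INR k) ^ 1) n)
    with (-1 * sum_n (fun k => / (x + INR k) ^ 1) n) by ring.
  rewrite <- sum_n_scal.
  apply sum_n_ext. intros k. unfold neg_ln_der. simpl. unfold Rdiv. ring.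
Qed.

Lemma hurwitz_sum_term_pos m x k : 0 < x -> 0 < / (x + INR k) ^ m.
Proof.
  intros Hx. pose proof (pos_INR k). apply Rinv_0_lt_compat, pow_lt. lra.
Qed.

Lemma hurwitz_sum_incr m n x : 0 < x -> hurwitz_sum m n x <= hurwitz_sum m (S n) x.
Proof.
  intros Hx. unfold hurwitz_sum. rewrite sum_n_S. pose proof (hurwitz_sum_term_pos m x (S n) Hx).
  lra.
Qed.

Lemma hurwitz_sum_ge_first m n x : 0 < x -> / x ^ m <= hurwitz_sum m n x.
Proof.
  intros Hx. induction n as [|n IH].
  - unfold hurwitz_sum. rewrite sum_O. change (INR 0) with 0. rewrite Rplus_0_r. lra.
  - pose proof (hurwitz_sum_incr m n x Hx). lra.
Qed.

(** Telescoping, from 1/t - 1/(t+1) <= 1/t^2. *)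
Lemma hurwitz_sum_2_lower n x : 0 < x -> / x - / (x + INR (S n)) <= hurwitz_sum 2 n x.
Proof.
  intros Hx. unfold hurwitz_sum. induction n as [|n IH].
  - rewrite sum_O. change (INR 1) with 1. change (INR 0) with 0. rewrite Rplus_0_r.
    assert (0 < / (x ^ 2 * (x + 1))).
    { apply Rinv_0_lt_compat, Rmult_lt_0_compat; [apply pow_lt|]; lra. }
    replace (/ x ^ 2) with (/ x - / (x + 1) + / (x ^ 2 * (x + 1))) by (field; lra). lra.
  - rewrite sum_n_S.
    rewrite (S_INR (S n)). pose proof (pos_INR (S n)). set (t := x + INR (S n)) in *.
    replace (x + (INR (S n) + 1)) with (t + 1) by (unfold t; ring).
    assert (0 < t) by (unfold t; lra).
    assert (0 < / (t ^ 2 * (t + 1))).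
    { apply Rinv_0_lt_compat, Rmult_lt_0_compat; [apply pow_lt|]; lra. }
    apply Rle_trans with (/ x - / t + / t ^ 2).
    + replace (/ t ^ 2) with (/ t - / (t + 1) + / (t ^ 2 * (t + 1))) by (field; lra). lra.
    + lra.
Qed.

(** Telescoping, from 1/(t+1)^2 <= 1/t - 1/(t+1). *)
Lemma hurwitz_sum_2_upper n x : 0 < x -> hurwitz_sum 2 n x <= / x ^ 2 + / x - / (x + INR n).
Proof.
  intros Hx. unfold hurwitz_sum. induction n as [|n IH].
  - rewrite sum_O. change (INR 0) with 0. rewrite Rplus_0_r. lra.
  - rewrite sum_n_S.
    rewrite S_INR. pose proof (pos_INR n). set (t := x + INR n) in *.
    replace (x + (INR n + 1)) with (t + 1) by (unfold t; ring).
    assert (0 < t) by (unfold t; lra).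
    assert (0 < / (t * (t + 1) ^ 2)).
    { apply Rinv_0_lt_compat, Rmult_lt_0_compat; [|apply pow_lt]; lra. }
    replace (/ (t + 1) ^ 2) with (/ t - / (t + 1) - / (t * (t + 1) ^ 2)) by (field; lra).
    lra.
Qed.

Lemma hurwitz_sum_bound m n r x : 0 < r <= x ->
  hurwitz_sum (S (S m)) n x <= / r ^ m * (/ r ^ 2 + / r).
Proof.
  intros Hr.
  apply Rle_trans with (/ r ^ m * hurwitz_sum 2 n r).
  - unfold hurwitz_sum. rewrite <- sum_n_scal.
    apply sum_n_m_le. intros k.
    rewrite <- Rinv_mult. pose proof (pos_INR k).
    assert (0 < r ^ m) by (apply pow_lt; lra).
    apply Rinv_le_contravar.
    + apply Rmult_lt_0_compat; auto. apply pow_lt. lra.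
    + replace ((x + INR k) ^ S (S m)) with ((x + INR k) ^ m * (x + INR k) ^ 2) by (simpl; ring).
      apply Rmult_le_compat.
      * lra.
      * apply pow_le; lra.
      * apply pow_incr. lra.
      * apply pow_incr. lra.
  - apply Rmult_le_compat_l.
    + left. apply Rinv_0_lt_compat, pow_lt. lra.
    + pose proof (hurwitz_sum_2_upper n r ltac:(lra)). pose proof (pos_INR n).
      assert (0 < / (r + INR n)) by (apply Rinv_0_lt_compat; lra). lra.
Qed.

Lemma ex_lim_hurwitz_sum m x : 0 < x -> ex_finite_lim_seq (fun n => hurwitz_sum (S (S m)) n x).
Proof.
  intros Hx. apply ex_finite_lim_seq_incr with (/ x ^ m * (/ x ^ 2 + / x)).
  - intros n. now apply hurwitz_sum_incr.
  - intros n. apply hurwitz_sum_bound. lra.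
Qed.

Lemma gauss_log_bound m n r x : 0 < r <= x ->
  Rabs (gauss_log (S (S m)) n x) <= INR (fact (S m)) * (/ r ^ m * (/ r ^ 2 + / r)).
Proof.
  intros Hr. rewrite gauss_log_hurwitz_sum, !Rabs_mult, pow_1_abs, Rmult_1_l.
  rewrite Rabs_pos_eq by apply pos_INR.
  apply Rmult_le_compat_l; [apply pos_INR|].
  rewrite Rabs_pos_eq.
  - now apply hurwitz_sum_bound.
  - apply Rle_trans with (/ x ^ S (S m)); [|apply hurwitz_sum_ge_first; lra].
    left. apply Rinv_0_lt_compat, pow_lt. lra.
Qed.

(** At x = 1 the sequence is ln(n+1) - H_(n+1) with H the harmonic numbers; it is
    monotone and bounded.  Other points are compared with this one below. *)
Lemma gauss_log_1_1_incr n : gauss_log 1 n 1 <= gauss_log 1 (S n) 1.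
Proof.
  rewrite !gauss_log_1. unfold hurwitz_sum. rewrite sum_n_S.
  rewrite pow_1. pose proof (INR_S_ge_1 n). rewrite (S_INR (S n)). set (t := INR (S n)) in *.
  pose proof (ln_le_sub_1 (t / (t + 1)) ltac:(apply Rdiv_lt_0_compat; lra)) as Hl.
  rewrite ln_div in Hl by lra.
  assert (/ (1 + t) = - (t / (t + 1) - 1)) by (field; lra).
  lra.
Qed.

(** The bound says ln(n+1) <= H_n; the extra - 1/(n+1) is what makes the induction
    go through. *)
Lemma gauss_log_1_1_upper n : gauss_log 1 n 1 <= - / INR (S n).
Proof.
  rewrite gauss_log_1. unfold hurwitz_sum. induction n as [|n IH].
  - rewrite sum_O. simpl. rewrite ln_1, Rplus_0_r, Rmult_1_r, Rinv_1. lra.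
  - rewrite sum_n_S.
    rewrite pow_1. pose proof (INR_S_ge_1 n).
    rewrite (S_INR (S n)). set (t := INR (S n)) in *.
    pose proof (ln_le_sub_1 ((t + 1) / t) ltac:(apply Rdiv_lt_0_compat; lra)) as Hl.
    rewrite ln_div in Hl by lra.
    replace ((t + 1) / t - 1) with (/ t) in Hl by (field; lra).
    rewrite (Rplus_comm t 1) in *.
    lra.
Qed.

(** The difference of the values at x and 1 is (x-1) sum 1/((1+k)(x+k)), and this
    sum is dominated by those of 1/(1+k)^2 and 1/(x+k)^2. *)
Lemma ex_lim_gauss_log_1 x : 0 < x -> ex_finite_lim_seq (fun n => gauss_log 1 n x).
Proof.
  intros Hx.
  assert (H1 : ex_finite_lim_seq (fun n => gauss_log 1 n 1)).
  { apply ex_finite_lim_seq_incr with 0; [apply gauss_log_1_1_incr|].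
    intros n. pose proof (gauss_log_1_1_upper n). pose proof (inv_INR_S_bounds n). lra. }
  assert (H2 : ex_finite_lim_seq (fun n => sum_n (fun k => / ((1 + INR k) * (x + INR k))) n)).
  { apply ex_finite_lim_seq_incr with ((/ 1 ^ 2 + / 1) + (/ x ^ 2 + / x)).
    - intros n. rewrite sum_n_S.
      pose proof (pos_INR (S n)).
      assert (0 < / ((1 + INR (S n)) * (x + INR (S n)))).
      { apply Rinv_0_lt_compat, Rmult_lt_0_compat; lra. }
      lra.
    - intros n. apply Rle_trans with (hurwitz_sum 2 n 1 + hurwitz_sum 2 n x).
      + unfold hurwitz_sum. rewrite <- sum_n_add.
        apply sum_n_m_le. intros k.
        pose proof (pos_INR k). rewrite Rinv_mult, <- !pow_inv.
        set (u := / (1 + INR k)). set (v := / (x + INR k)).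
        pose proof (pow2_ge_0 (u - v)). pose proof (pow2_ge_0 u). pose proof (pow2_ge_0 v).
        nra.
      + pose proof (hurwitz_sum_bound 0 n 1 1 ltac:(lra)).
        pose proof (hurwitz_sum_bound 0 n x x ltac:(lra)). simpl pow in *. lra. }
  destruct H1 as [l1 H1]. destruct H2 as [l2 H2].
  exists (l1 + (x - 1) * l2).
  apply is_lim_seq_ext with
    (fun n => gauss_log 1 n 1 + (x - 1) * sum_n (fun k => / ((1 + INR k) * (x + INR k))) n).
  - intros n. rewrite !gauss_log_1. unfold hurwitz_sum.
    assert (E : sum_n (fun k => / (1 + INR k) ^ 1) n =
      sum_n (fun k => / (x + INR k) ^ 1) n
       + (x - 1) * sum_n (fun k => / ((1 + INR k) * (x + INR k))) n :> R).
    { rewrite <- sum_n_scal, <- sum_n_add.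
      apply sum_n_ext. intros k.
      pose proof (pos_INR k). simpl; field. lra. }
    rewrite E. simpl. ring.
  - apply is_lim_seq_plus'; auto.
    now apply (is_lim_seq_scal_l _ (x - 1) l2).
Qed.

Lemma gauss_log_0_succ n x : 0 < x ->
  gauss_log 0 n (x + 1) = gauss_log 0 n x + ln x + (ln (INR (S n)) - ln (x + INR (S n))).
Proof.
  intros Hx. unfold gauss_log, gauss_log_affine, neg_ln_der.
  assert (E : sum_n (fun k => - ln (x + 1 + INR k)) n =
     sum_n (fun k => - ln (x + INR k)) n + ln x - ln (x + INR (S n)) :> R).
  { induction n as [|n IH].
    - rewrite !sum_O. rewrite S_INR. change (INR 0) with 0. rewrite !Rplus_0_r, Rplus_0_l. ring.
    - rewrite !sum_n_S, IH.
      rewrite (S_INR (S n)). replace (x + 1 + INR (S n)) with (x + (INR (S n) + 1)) by ring.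
      ring. }
  rewrite E. ring.
Qed.

Lemma lim_ln_shift x : 0 < x ->
  is_lim_seq (fun n => ln (INR (S n)) - ln (x + INR (S n))) 0.
Proof.
  intros Hx.
  apply is_lim_seq_le_le with (u := fun n => - (x * / INR (S n))) (w := fun _ => 0).
  - intros n. pose proof (INR_S_ge_1 n). set (t := INR (S n)) in *.
    pose proof (ln_le_sub_1 ((x + t) / t) ltac:(apply Rdiv_lt_0_compat; lra)) as Hl.
    rewrite ln_div in Hl by lra.
    replace ((x + t) / t - 1) with (x * / t) in Hl by (field; lra).
    assert (ln t <= ln (x + t)) by (apply ln_le; lra). lra.
  - rewrite <- Ropp_0. apply (is_lim_seq_opp _ 0).
    rewrite <- (Rmult_0_r x). apply (is_lim_seq_scal_l _ x 0). apply lim_inv_INR_S.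
  - apply is_lim_seq_const.
Qed.

Lemma ln_Gamma_succ x : 0 < x -> ln (Gamma (x + 1)) = ln x + ln (Gamma x).
Proof. intros Hx. rewrite Gamma_succ by auto. apply ln_mult; auto. now apply Gamma_pos. Qed.

Lemma Gamma_fact n : Gamma (INR (S n)) = INR (fact n).
Proof.
  induction n as [|n IH].
  - simpl. apply Gamma_1.
  - rewrite S_INR, Gamma_succ, IH.
    + rewrite fact_simpl, mult_INR. reflexivity.
    + pose proof (INR_S_ge_1 n). lra.
Qed.

Lemma ln_Gamma_shift n x : 0 < x ->
  ln (Gamma x) = ln (Gamma (x + INR (S n))) + sum_n (fun k => - ln (x + INR k)) n.
Proof.
  intros Hx. induction n as [|n IH].
  - rewrite sum_O. change (INR 1) with 1. change (INR 0) with 0.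
    rewrite Rplus_0_r, ln_Gamma_succ by auto. ring.
  - rewrite sum_n_S, IH.
    rewrite (S_INR (S n)). pose proof (INR_S_ge_1 n).
    replace (x + (INR (S n) + 1)) with (x + INR (S n) + 1) by ring.
    rewrite ln_Gamma_succ by lra. ring.
Qed.

(** After shifting by n+1, the claim compares Gamma(n+1+x) with (n+1)^x n!; Wendel's
    inequality bounds it from both sides when x <= 1. *)
Lemma lim_gauss_log_0_unit x : 0 < x <= 1 -> is_lim_seq (fun n => gauss_log 0 n x) (ln (Gamma x)).
Proof.
  intros Hx.
  (* Wendel's inequality from n+1 to n+1+x, and from n+1+x to n+2 *)
  apply is_lim_seq_le_le with (u := fun n => ln (Gamma x))
   (w := fun n => ln (Gamma x) + (x - 1) * (ln (INR (S n)) - ln (x + INR (S n)))).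
  - intros n. rewrite (ln_Gamma_shift n x) by lra.
    unfold gauss_log, gauss_log_affine, neg_ln_der.
    pose proof (INR_S_ge_1 n). pose proof (Gamma_fact n) as Hf.
    assert (Hfs : Gamma (INR (S n) + 1) = INR (S n) * INR (fact n)).
    { rewrite Gamma_succ, Hf; lra. }
    set (t := INR (S n)) in *.
    pose proof (INR_fact_lt_0 n) as Hfp.
    pose proof (Gamma_wendel t x ltac:(lra) ltac:(lra)) as W1.
    pose proof (Gamma_wendel (t + x) (1 - x) ltac:(lra) ltac:(lra)) as W2.
    replace (t + x + (1 - x)) with (t + 1) in W2 by ring.
    rewrite Hfs in W2. rewrite Hf in W1.
    rewrite (Rplus_comm t x) in *.
    pose proof (Gamma_pos (x + t) ltac:(lra)) as Hg.
    apply ln_le in W1; auto.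
    apply ln_le in W2; [|apply Rmult_lt_0_compat; lra].
    rewrite ln_mult in W1 by (auto; apply exp_pos).
    rewrite !ln_mult in W2 by (auto; try lra; apply exp_pos).
    unfold Rpower in W1, W2. rewrite ln_exp in W1, W2. split; nra.
  - apply is_lim_seq_const.
  - replace (Finite (ln (Gamma x))) with (Finite (ln (Gamma x) + 0)) by (f_equal; ring).
    apply is_lim_seq_plus'; [apply is_lim_seq_const|].
    rewrite <- (Rmult_0_r (x - 1)). apply (is_lim_seq_scal_l _ (x - 1) 0).
    apply lim_ln_shift. lra.
Qed.

Lemma lim_gauss_log_0 x : 0 < x -> is_lim_seq (fun n => gauss_log 0 n x) (ln (Gamma x)).
Proof.
  intros Hx.
  assert (H : forall N x, 0 < x <= INR (S N) ->
            is_lim_seq (fun n => gauss_log 0 n x) (ln (Gamma x))).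
  { induction N as [|N IH]; intros y Hy.
    - now apply lim_gauss_log_0_unit.
    - destruct (Rle_dec y 1) as [H1|H1]; [apply lim_gauss_log_0_unit; lra|].
      rewrite S_INR in Hy. replace y with (y - 1 + 1) by ring.
      rewrite ln_Gamma_succ by lra.
      apply is_lim_seq_ext with (fun n => gauss_log 0 n (y - 1) + ln (y - 1)
          + (ln (INR (S n)) - ln (y - 1 + INR (S n)))).
      { intros n. symmetry. apply gauss_log_0_succ. lra. }
      replace (ln (y - 1) + ln (Gamma (y - 1))) with (ln (Gamma (y - 1)) + ln (y - 1) + 0) by ring.
      apply is_lim_seq_plus'; [apply is_lim_seq_plus'|].
      + apply IH. lra.
      + apply is_lim_seq_const.
      + apply lim_ln_shift. lra. }
  destruct (INR_unbounded x) as [N HN]. apply (H N). rewrite S_INR. lra.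
Qed.

(** * The derivatives of ln Gamma *)

(** Indexed so that the order 0 is ln Gamma and the order 1 is digamma. *)
Definition polygamma (m : nat) (x : R) : R := real (Lim_seq (fun n => gauss_log m n x)).

Lemma polygamma_0 x : 0 < x -> polygamma 0 x = ln (Gamma x).
Proof. intros Hx. unfold polygamma. now rewrite (is_lim_seq_unique _ _ (lim_gauss_log_0 x Hx)). Qed.

Lemma lim_gauss_log m x : 0 < x -> is_lim_seq (fun n => gauss_log m n x) (polygamma m x).
Proof.
  intros Hx. apply Lim_seq_correct'. destruct m as [|[|m]].
  - eexists. now apply lim_gauss_log_0.
  - now apply ex_lim_gauss_log_1.
  - destruct (ex_lim_hurwitz_sum m x Hx) as [l Hl].
    exists ((-1) ^ m * INR (fact (S m)) * l).
    apply is_lim_seq_ext with (1 := fun n => eq_sym (gauss_log_hurwitz_sum m n x)).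
    now apply (is_lim_seq_scal_l _ _ l).
Qed.

Lemma is_derive_polygamma m x : 0 < x -> is_derive (polygamma m) x (polygamma (S m) x).
Proof.
  intros Hx.
  apply (is_derive_lim_seq (gauss_log m) (gauss_log (S m)) (gauss_log (S (S m))) (polygamma m) _
    (INR (fact (S m)) * (/ (x / 2) ^ m * (/ (x / 2) ^ 2 + / (x / 2)))) (x / 2)).
  - lra.
  - intros n y Hy. apply Rabs_def2 in Hy. split; [|split].
    + apply is_derive_gauss_log. lra.
    + apply is_derive_gauss_log. lra.
    + apply gauss_log_bound. lra.
  - intros y Hy. apply Rabs_def2 in Hy. apply lim_gauss_log. lra.
  - now apply lim_gauss_log.
Qed.

(** As a constant, ln Gamma is differentiated as a whole; [auto_derive] would
    otherwise ask for the derivative of Gamma. *)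
Definition ln_Gamma (x : R) : R := ln (Gamma x).

Lemma is_derive_ln_Gamma x : 0 < x -> is_derive ln_Gamma x (polygamma 1 x).
Proof.
  intros Hx. apply is_derive_ext_loc with (polygamma 0).
  - apply (filter_imp (fun y => 0 < y)); [apply polygamma_0 | now apply open_gt].
  - now apply is_derive_polygamma.
Qed.

Lemma digamma_polygamma x : 0 < x -> digamma x = polygamma 1 x.
Proof.
  intros Hx. pose proof (is_derive_ln_Gamma x Hx) as D.
  assert (D2 : is_derive Gamma x (polygamma 1 x * Gamma x)).
  { apply is_derive_ext_loc with (fun t => exp (ln (Gamma t))).
    - apply (filter_imp (fun y => 0 < y)); [|now apply open_gt].
      intros y Hy. now apply exp_ln, Gamma_pos.
    - rewrite <- (exp_ln (Gamma x)) by now apply Gamma_pos.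
      apply (is_derive_comp exp (fun t => ln (Gamma t))); auto. apply is_derive_exp. }
  unfold digamma. rewrite (is_derive_unique _ _ _ D2). field.
  apply Rgt_not_eq. now apply Gamma_pos.
Qed.

Lemma polygamma_sign m x : 0 < x -> 0 < (-1) ^ m * polygamma (S (S m)) x.
Proof.
  intros Hx. apply Rlt_le_trans with (INR (fact (S m)) * / x ^ S (S m)).
  - apply Rmult_lt_0_compat; [apply INR_fact_lt_0|]. now apply Rinv_0_lt_compat, pow_lt.
  - apply (is_lim_seq_le (fun _ => INR (fact (S m)) * / x ^ S (S m))
       (fun n => (-1) ^ m * gauss_log (S (S m)) n x)
       (INR (fact (S m)) * / x ^ S (S m)) ((-1) ^ m * polygamma (S (S m)) x)).
    + intros n. rewrite gauss_log_hurwitz_sum, <- !Rmult_assoc, <- Rpow_mult_distr.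
      replace (-1 * -1) with 1 by ring. rewrite pow1, Rmult_1_l.
      apply Rmult_le_compat_l; [apply pos_INR|]. now apply hurwitz_sum_ge_first.
    + apply is_lim_seq_const.
    + apply (is_lim_seq_scal_l _ _ (polygamma (S (S m)) x)). now apply lim_gauss_log.
Qed.

(** This lower bound is what makes [slope_num] unbounded above at infinity. *)
Lemma trigamma_ge_inv x : 0 < x -> / x <= polygamma 2 x.
Proof.
  intros Hx.
  apply (is_lim_seq_le (fun n => / x - / (x + INR (S n))) (fun n => gauss_log 2 n x)
     (/ x) (polygamma 2 x)).
  - intros n. rewrite gauss_log_hurwitz_sum. simpl pow at 1. simpl fact. change (INR 1) with 1.
    pose proof (hurwitz_sum_2_lower n x Hx). lra.
  - replace (Finite (/ x)) with (Finite (/ x - 0)) by (f_equal; ring).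
    apply is_lim_seq_minus'; [apply is_lim_seq_const|].
    apply is_lim_seq_le_le with (u := fun _ => 0) (w := fun n => / INR (S n)).
    + intros n. pose proof (INR_S_ge_1 n). split.
      * left; apply Rinv_0_lt_compat; lra.
      * apply Rinv_le_contravar; lra.
    + apply is_lim_seq_const.
    + apply lim_inv_INR_S.
  - now apply lim_gauss_log.
Qed.

Lemma polygamma_1_succ x : 0 < x -> polygamma 1 (x + 1) = polygamma 1 x + / x.
Proof.
  intros Hx. pose proof (is_derive_polygamma 0 (x + 1) ltac:(lra)) as D1.
  assert (D2 : is_derive (fun y => polygamma 0 (y + 1)) x (polygamma 1 (x + 1))).
  { rewrite <- (Rmult_1_l (polygamma 1 (x + 1))).
    apply (is_derive_comp (polygamma 0) (fun y => y + 1)); auto. auto_derive; auto. }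
  assert (D3 : is_derive (fun y => polygamma 0 (y + 1)) x (polygamma 1 x + / x)).
  { apply is_derive_ext_loc with (fun y => polygamma 0 y + ln y).
    - apply (filter_imp (fun y => 0 < y)); [|now apply open_gt]. intros y Hy.
      rewrite !polygamma_0, ln_Gamma_succ by lra. lra.
    - apply (is_derive_plus (polygamma 0) ln). now apply is_derive_polygamma.
      now apply is_derive_ln. }
  apply is_derive_unique in D2. apply is_derive_unique in D3. congruence.
Qed.

Lemma polygamma_1_1 : polygamma 1 1 = - euler_gamma.
Proof.
  unfold euler_gamma.
  assert (L : is_lim_seq
     (fun n => sum_n_m (fun k => / INR k) 1 n - ln (INR n)) (- polygamma 1 1)).
  { apply is_lim_seq_incr_1.
    apply is_lim_seq_ext with (fun n => - gauss_log 1 n 1).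
    - intros n. rewrite gauss_log_1. unfold hurwitz_sum, sum_n.
      rewrite <- sum_n_m_S.
      rewrite (sum_n_m_ext (fun k => / INR (S k)) (fun k => / (1 + INR k) ^ 1)).
      + ring.
      + intros k. rewrite pow_1, S_INR. f_equal. apply Rplus_comm.
    - apply (is_lim_seq_opp _ (polygamma 1 1)). apply lim_gauss_log. lra. }
  rewrite (is_lim_seq_unique _ _ L). simpl. ring.
Qed.

Lemma polygamma_1_incr s t : 0 < s -> s < t -> polygamma 1 s < polygamma 1 t.
Proof.
  intros Hs Hst.
  destruct (mean_value (polygamma 1) (polygamma 2) s t Hst) as (c & Hc & E).
  - intros z Hz. apply is_derive_polygamma. lra.
  - pose proof (polygamma_sign 0 c ltac:(lra)). simpl in H. nra.
Qed.

Lemma ln_Gamma_mean_value s t : 0 < s -> s < t ->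
  exists c, s < c < t /\ ln (Gamma t) - ln (Gamma s) = polygamma 1 c * (t - s).
Proof.
  intros Hs Hst. apply (mean_value ln_Gamma (polygamma 1)); auto.
  intros z Hz. apply is_derive_ln_Gamma. lra.
Qed.

Lemma Gamma_2 : Gamma 2 = 1.
Proof. replace 2 with (1 + 1) by ring. rewrite Gamma_succ, Gamma_1; lra. Qed.

(** Rolle's theorem, as Gamma(1) = Gamma(2). *)
Lemma digamma_root : exists c, 1 < c < 2 /\ polygamma 1 c = 0.
Proof.
  destruct (ln_Gamma_mean_value 1 2) as (c & Hc & E); try lra.
  exists c. split; auto. rewrite Gamma_1, Gamma_2 in E. lra.
Qed.

Lemma ln_Gamma_nonpos t : 1 <= t <= 2 -> ln (Gamma t) <= 0.
Proof.
  intros Ht. destruct digamma_root as (c & Hc & E).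
  destruct (Req_dec t 1) as [-> | H1]; [rewrite Gamma_1, ln_1; lra|].
  destruct (Req_dec t 2) as [-> | H2]; [rewrite Gamma_2, ln_1; lra|].
  destruct (Rle_dec t c).
  - destruct (ln_Gamma_mean_value 1 t) as (d & Hd & Ed); try lra.
    rewrite Gamma_1, ln_1 in Ed.
    pose proof (polygamma_1_incr d c ltac:(lra) ltac:(lra)). nra.
  - destruct (ln_Gamma_mean_value t 2) as (d & Hd & Ed); try lra.
    rewrite Gamma_2, ln_1 in Ed.
    pose proof (polygamma_1_incr c d ltac:(lra) ltac:(lra)). nra.
Qed.

Lemma ln_Gamma_gt_0 t : 0 < t < 1 \/ 2 < t -> 0 < ln (Gamma t).
Proof.
  intros Ht. destruct digamma_root as (c & Hc & E). destruct Ht as [Ht | Ht].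
  - destruct (ln_Gamma_mean_value t 1) as (d & Hd & Ed); try lra.
    rewrite Gamma_1, ln_1 in Ed.
    pose proof (polygamma_1_incr d c ltac:(lra) ltac:(lra)). nra.
  - destruct (ln_Gamma_mean_value 2 t) as (d & Hd & Ed); try lra.
    rewrite Gamma_2, ln_1 in Ed.
    pose proof (polygamma_1_incr c d ltac:(lra) ltac:(lra)). nra.
Qed.

(** * The sign of the derivative of ln g1 *)

(** The derivative of ln Gamma(x+a) / x, multiplied by x^2. *)
Definition slope_num (a x : R) : R := x * polygamma 1 (x + a) - ln (Gamma (x + a)).

Lemma is_derive_slope_num a x : - a < x ->
  is_derive (slope_num a) x (x * polygamma 2 (x + a)).
Proof.
  intros Hx.
  assert (D1 := is_derive_polygamma 1 (x + a) ltac:(lra)).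
  assert (D2 := is_derive_ln_Gamma (x + a) ltac:(lra)).
  change (is_derive (fun y => y * polygamma 1 (y + a) - ln_Gamma (y + a)) x
            (x * polygamma 2 (x + a))).
  auto_derive.
  - split; [eexists; apply D1|]. split; [eexists; apply D2|auto].
  - rewrite (is_derive_unique (fun y : R => polygamma 1 y) _ _ D1),
      (is_derive_unique (fun y : R => ln_Gamma y) _ _ D2). unfold ln_Gamma. ring.
Qed.

Lemma trigamma_pos x : 0 < x -> 0 < polygamma 2 x.
Proof. intros Hx. pose proof (polygamma_sign 0 x Hx). simpl in H. lra. Qed.

Lemma slope_num_mean_value a x y : - a < x -> x < y ->
  exists c, x < c < y /\
    slope_num a y - slope_num a x = c * polygamma 2 (c + a) * (y - x).
Proof.
  intros Hx Hxy.
  apply (mean_value (slope_num a) (fun z => z * polygamma 2 (z + a))); auto.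
  intros z Hz. apply is_derive_slope_num. lra.
Qed.

Lemma slope_num_incr a x y : - a < x -> 0 <= x -> x < y -> slope_num a x < slope_num a y.
Proof.
  intros Ha Hx Hxy. destruct (slope_num_mean_value a x y) as (c & Hc & E); auto.
  pose proof (trigamma_pos (c + a) ltac:(lra)).
  assert (0 < c * polygamma 2 (c + a) * (y - x)).
  { repeat apply Rmult_lt_0_compat; lra. }
  lra.
Qed.

Lemma slope_num_decr a x y : - a < x -> x < y -> y <= 0 -> slope_num a y < slope_num a x.
Proof.
  intros Ha Hxy Hy. destruct (slope_num_mean_value a x y) as (c & Hc & E); auto.
  pose proof (trigamma_pos (c + a) ltac:(lra)).
  assert (0 < (- c) * polygamma 2 (c + a) * (y - x)).
  { repeat apply Rmult_lt_0_compat; lra. }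
  lra.
Qed.

Lemma slope_num_0 a : slope_num a 0 = - ln (Gamma a).
Proof. unfold slope_num. rewrite Rplus_0_l. ring. Qed.

Lemma slope_num_zero a x y : - a < x -> x < y ->
  slope_num a x < 0 < slope_num a y \/ slope_num a y < 0 < slope_num a x ->
  exists c, x < c < y /\ slope_num a c = 0.
Proof.
  intros Hx Hxy. apply (zero_between _ (fun z => z * polygamma 2 (z + a))); auto.
  intros z Hz. apply is_derive_slope_num. lra.
Qed.

(** The derivative x psi'(x+a) is at least x/(x+a), hence at least 1/3 for x >= |a|;
    so doubling y raises the value by at least y/3. *)
Lemma slope_num_pos_at_infinity a : exists y, 0 < y /\ - a < y /\ 0 < slope_num a y.
Proof.
  set (y0 := Rabs a + 1). assert (Hy0 : 0 < y0 /\ a < y0 /\ - a < y0).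
  { unfold y0. pose proof (Rle_abs a). pose proof (Rabs_maj2 a). pose proof (Rabs_pos a). lra. }
  set (y := y0 + 3 * Rabs (slope_num a y0)).
  assert (Hy : y0 <= y) by (unfold y; pose proof (Rabs_pos (slope_num a y0)); lra).
  exists (2 * y). repeat split; try lra.
  assert (H1 : slope_num a y0 <= slope_num a y).
  { destruct Hy as [Hy | <-]; [|lra]. left. apply slope_num_incr; lra. }
  destruct (slope_num_mean_value a y (2 * y)) as (c & Hc & E); try lra.
  pose proof (trigamma_ge_inv (c + a) ltac:(lra)) as Ht.
  assert (H2 : / 3 <= c * polygamma 2 (c + a)).
  { apply Rle_trans with (c * / (c + a)).
    - apply (Rle_div_r (/ 3) c (c + a)); lra.
    - apply Rmult_le_compat_l; lra. }
  assert (H3 : / 3 * y <= slope_num a (2 * y) - slope_num a y).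
  { rewrite E. replace (2 * y - y) with y by ring. apply Rmult_le_compat_r; lra. }
  pose proof (Rle_abs (- slope_num a y0)). rewrite Rabs_Ropp in H. unfold y in *. lra.
Qed.

(** With t = x+a, the relations psi(t) = psi(t+1) - 1/t and
    L(t) = L(t+1) - ln t isolate the singular part; psi and L are bounded on [1,2]. *)
Lemma slope_num_near_pole a : exists B, 0 < B /\ forall t, 0 < t < 1 ->
  Rabs (slope_num a (t - a) - (a / t + ln t)) <= B.
Proof.
  exists (1 + (1 + Rabs a) * (Rabs (polygamma 1 1) + Rabs (polygamma 1 2))
            + Rabs (polygamma 1 1)).
  split.
  { pose proof (Rabs_pos a). pose proof (Rabs_pos (polygamma 1 1)).
    pose proof (Rabs_pos (polygamma 1 2)). nra. }
  intros t Ht. unfold slope_num. replace (t - a + a) with t by ring.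
  pose proof (polygamma_1_succ t ltac:(lra)) as E1.
  pose proof (ln_Gamma_succ t ltac:(lra)) as E2.
  replace ((t - a) * polygamma 1 t - ln (Gamma t) - (a / t + ln t))
    with (- 1 + (t - a) * polygamma 1 (t + 1) + - ln (Gamma (t + 1))).
  2: { rewrite E2. replace (polygamma 1 t) with (polygamma 1 (t + 1) - / t) by lra. field. lra. }
  assert (B1 : Rabs (polygamma 1 (t + 1)) <= Rabs (polygamma 1 1) + Rabs (polygamma 1 2)).
  { pose proof (polygamma_1_incr 1 (t + 1)). pose proof (polygamma_1_incr (t + 1) 2).
    unfold Rabs. repeat destruct Rcase_abs; lra. }
  assert (B2 : Rabs (t - a) <= 1 + Rabs a).
  { unfold Rabs. repeat destruct Rcase_abs; lra. }
  assert (B3 : Rabs (- ln (Gamma (t + 1))) <= Rabs (polygamma 1 1)).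
  { pose proof (ln_Gamma_nonpos (t + 1) ltac:(lra)).
    destruct (ln_Gamma_mean_value 1 (t + 1)) as (c & Hc & E); try lra.
    rewrite Gamma_1, ln_1 in E. pose proof (polygamma_1_incr 1 c).
    rewrite Rabs_pos_eq by lra.
    pose proof (Rabs_maj2 (polygamma 1 1)).
    pose proof (Rabs_pos (polygamma 1 1)). nra. }
  eapply Rle_trans; [apply Rabs_triang|]. apply Rplus_le_compat; auto.
  eapply Rle_trans; [apply Rabs_triang|]. apply Rplus_le_compat.
  - rewrite Rabs_left; lra.
  - rewrite Rabs_mult. apply Rmult_le_compat; auto using Rabs_pos.
Qed.

Lemma slope_num_neg_near_pole a : a <= 0 -> exists x, - a < x /\ slope_num a x < 0.
Proof.
  intros Ha. destruct (slope_num_near_pole a) as (B & HB & H).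
  set (t := exp (- (B + 1))).
  assert (Ht : 0 < t < 1).
  { split; [apply exp_pos|]. rewrite <- exp_0. apply exp_increasing. lra. }
  exists (t - a). split; [lra|].
  specialize (H t Ht). apply Rabs_le_between in H.
  assert (a / t <= 0) by (apply (Rle_div_l a 0 t); lra).
  assert (ln t = - (B + 1)) by (unfold t; apply ln_exp). lra.
Qed.

(** The term a/t outweighs ln t: half of it absorbs - ln t, by ln u <= u - 1 at
    u = (a/2)/t, and the other half exceeds any constant. *)
Lemma slope_num_pos_near_pole a : 0 < a -> exists x, - a < x < 0 /\ 0 < slope_num a x.
Proof.
  intros Ha. destruct (slope_num_near_pole a) as (B & HB & H).
  set (M := B + Rabs (ln (a / 2)) + 1).
  assert (HM : 0 < M) by (unfold M; pose proof (Rabs_pos (ln (a / 2))); lra).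
  set (t := Rmin (a / 2) (Rmin (/ 2) (a / 2 / M))).
  assert (Ht : 0 < t /\ t <= a / 2 /\ t <= / 2 /\ t <= a / 2 / M).
  { assert (0 < a / 2 / M) by (apply Rdiv_lt_0_compat; lra).
    unfold t. repeat split.
    - repeat apply Rmin_glb_lt; lra.
    - apply Rmin_l.
    - eapply Rle_trans; [apply Rmin_r | apply Rmin_l].
    - eapply Rle_trans; [apply Rmin_r | apply Rmin_r]. }
  exists (t - a). split; [lra|].
  specialize (H t ltac:(lra)). apply Rabs_le_between in H.
  pose proof (ln_le_sub_1 (a / 2 / t) ltac:(apply Rdiv_lt_0_compat; lra)) as Hl.
  rewrite ln_div in Hl by lra.
  assert (H3 : M <= a / 2 / t).
  { apply (Rle_div_r M (a / 2) t); [lra|]. destruct Ht as (Ht & _ & _ & HtM).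
    apply (Rle_div_r t (a / 2) M) in HtM; lra. }
  replace (a / t) with (a / 2 / t + a / 2 / t) in H by (field; lra).
  pose proof (Rabs_maj2 (ln (a / 2))). unfold M in H3. lra.
Qed.

Lemma slope_num_signs_nonpos a : a <= 0 ->
  exists x0, - a < x0 /\ slope_num a x0 = 0 /\
    (forall x, - a < x < x0 -> slope_num a x < 0) /\
    (forall x, x0 < x -> 0 < slope_num a x).
Proof.
  intros Ha.
  destruct (slope_num_neg_near_pole a Ha) as (u & Hu & Nu).
  destruct (slope_num_pos_at_infinity a) as (v & Hv0 & Hv & Pv).
  assert (Huv : u < v).
  { apply Rnot_le_lt. intros [H | H].
    - pose proof (slope_num_incr a v u). lra.
    - rewrite H in Pv. lra. }
  destruct (slope_num_zero a u v) as (x0 & H0 & E); auto.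
  exists x0. repeat split; try lra; auto.
  - intros x Hx. rewrite <- E. apply slope_num_incr; lra.
  - intros x Hx. rewrite <- E. apply slope_num_incr; lra.
Qed.

Lemma slope_num_signs_outside a : 0 < a < 1 \/ 2 < a ->
  exists x1 x2, - a < x1 /\ x1 < 0 < x2 /\ slope_num a x1 = 0 /\ slope_num a x2 = 0 /\
    (forall x, - a < x < x1 -> 0 < slope_num a x) /\
    (forall x, x1 < x < x2 -> slope_num a x < 0) /\
    (forall x, x2 < x -> 0 < slope_num a x).
Proof.
  intros Ha. pose proof (ln_Gamma_gt_0 a Ha) as HL.
  pose proof (slope_num_0 a) as E0.
  destruct (slope_num_pos_near_pole a ltac:(lra)) as (u & Hu & Pu).
  destruct (slope_num_pos_at_infinity a) as (v & Hv0 & Hv & Pv).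
  destruct (slope_num_zero a u 0) as (x1 & H1 & E1); try lra.
  destruct (slope_num_zero a 0 v) as (x2 & H2 & E2); try lra.
  exists x1, x2. repeat split; try lra.
  - intros x Hx. rewrite <- E1. apply slope_num_decr; lra.
  - intros x Hx. destruct (Rle_dec x 0).
    + rewrite <- E1. apply slope_num_decr; lra.
    + rewrite <- E2. apply slope_num_incr; lra.
  - intros x Hx. rewrite <- E2. apply slope_num_incr; lra.
Qed.

Lemma slope_num_signs_inside a x : 1 <= a <= 2 -> - a < x -> x <> 0 -> 0 < slope_num a x.
Proof.
  intros Ha Hx H0. pose proof (ln_Gamma_nonpos a Ha) as HL.
  pose proof (slope_num_0 a) as E0.
  destruct (Rlt_dec x 0).
  - pose proof (slope_num_decr a x 0). lra.
  - pose proof (slope_num_incr a 0 x). lra.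
Qed.

(** * Monotonicity of g1 *)

Lemma g1_val a x : x <> 0 -> g1 a x = exp (- (ln (Gamma (x + a)) / x)).
Proof.
  intros Hx. unfold g1; simpl. destruct (Req_EM_T x 0); [contradiction|].
  unfold Rpower. rewrite exp_Ropp. unfold Rdiv at 1. rewrite Rmult_1_l. f_equal. f_equal.
  field. auto.
Qed.

Lemma is_derive_ln_g1 a x : - a < x -> x <> 0 ->
  is_derive (fun y => ln (g1 a y)) x (- (slope_num a x / x ^ 2)).
Proof.
  intros Hx H0.
  apply is_derive_ext_loc with (fun y => - (ln (Gamma (y + a)) / y)).
  - apply (filter_imp (fun y => y <> 0)).
    + intros y Hy. now rewrite g1_val, ln_exp.
    + now apply open_neq.
  - assert (D := is_derive_ln_Gamma (x + a) ltac:(lra)).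
    change (is_derive (fun y => - (ln_Gamma (y + a) / y)) x (- (slope_num a x / x ^ 2))).
    auto_derive.
    + repeat split; auto. eexists; apply D.
    + rewrite (is_derive_unique (fun y : R => ln_Gamma y) _ _ D).
      unfold slope_num, ln_Gamma. field. auto.
Qed.

Lemma g1_monotone_step a x y : - a < x -> x < y -> (forall z, x <= z <= y -> z <> 0) ->
  exists c, x < c < y /\ ln (g1 a y) - ln (g1 a x) = - (slope_num a c / c ^ 2) * (y - x).
Proof.
  intros Hx Hxy H0.
  apply (mean_value (fun z => ln (g1 a z)) (fun z => - (slope_num a z / z ^ 2))); auto.
  intros z Hz. apply is_derive_ln_g1; auto. lra.
Qed.

Lemma g1_pos a x : x <> 0 -> 0 < g1 a x.
Proof. intros Hx. rewrite g1_val by auto. apply exp_pos. Qed.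

Lemma open_itv_fin l r x : open_itv (Finite l) (Finite r) x <-> l < x < r.
Proof. unfold open_itv; simpl; tauto. Qed.

Lemma open_itv_p_infty l x : open_itv (Finite l) p_infty x <-> l < x.
Proof. unfold open_itv; simpl; tauto. Qed.

Lemma open_itv_convex l r x y z :
  open_itv l r x -> open_itv l r y -> x <= z <= y -> open_itv l r z.
Proof.
  intros [H1 _] [_ H2] Hz. split.
  - apply Rbar_lt_le_trans with (1 := H1). apply Hz.
  - apply Rbar_le_lt_trans with (2 := H2). apply Hz.
Qed.

Lemma g1_strictly_decreasing a l r :
  (forall x, open_itv l r x -> - a < x /\ x <> 0 /\ 0 < slope_num a x) ->
  strictly_decreasing_on (g1 a) (open_itv l r).
Proof.
  intros H. split.
  - intros x Hx. destruct (H x Hx) as (H1 & H2 & _). simpl. auto.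
  - intros x y Dx Dy Hxy.
    destruct (g1_monotone_step a x y) as (c & Hc & E); auto.
    + now apply H.
    + intros z Hz. apply (H z). now apply open_itv_convex with x y.
    + assert (Dc : open_itv l r c) by (apply open_itv_convex with x y; auto; lra).
      destruct (H c Dc) as (_ & Hc0 & Pc).
      assert (0 < slope_num a c / c ^ 2 * (y - x)).
      { apply Rmult_lt_0_compat; [apply Rdiv_lt_0_compat|]; auto; try lra. now apply pow2_gt_0. }
      apply ln_lt_inv; try (apply g1_pos; now apply H). lra.
Qed.

Lemma g1_strictly_increasing a l r :
  (forall x, open_itv l r x -> - a < x /\ x <> 0 /\ slope_num a x < 0) ->
  strictly_increasing_on (g1 a) (open_itv l r).
Proof.
  intros H. split.
  - intros x Hx. destruct (H x Hx) as (H1 & H2 & _). simpl. auto.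
  - intros x y Dx Dy Hxy.
    destruct (g1_monotone_step a x y) as (c & Hc & E); auto.
    + now apply H.
    + intros z Hz. apply (H z). now apply open_itv_convex with x y.
    + assert (Dc : open_itv l r c) by (apply open_itv_convex with x y; auto; lra).
      destruct (H c Dc) as (_ & Hc0 & Pc).
      assert (0 < - slope_num a c / c ^ 2 * (y - x)).
      { apply Rmult_lt_0_compat; [apply Rdiv_lt_0_compat|]; auto; try lra. now apply pow2_gt_0. }
      apply ln_lt_inv; try (apply g1_pos; now apply H). lra.
Qed.

(** * Logarithmic complete monotonicity *)

(** The m-th derivative of (ln Gamma(x+a) - ln Gamma(a)) / x, which is the mean of
    psi over the segment from a to a+x.  In this integral form the quotient has no
    singularity at x = 0. *)
Definition mean_polygamma (a : R) (m : nat) (x : R) : R :=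
  RInt (fun s => s ^ m * polygamma (S m) (a + s * x)) 0 1.

Lemma segment_pos a x s : 0 < a -> - a < x -> 0 <= s <= 1 -> 0 < a + s * x.
Proof.
  intros Ha Hx Hs. replace (a + s * x) with ((1 - s) * a + s * (a + x)) by ring.
  destruct (Rlt_dec s 1).
  - assert (0 < (1 - s) * a) by (apply Rmult_lt_0_compat; lra).
    assert (0 <= s * (a + x)) by (apply Rmult_le_pos; lra). lra.
  - replace s with 1 by lra. lra.
Qed.

Lemma is_derive_mean_integrand a m x s : 0 < a + s * x ->
  is_derive (fun u => s ^ m * polygamma (S m) (a + s * u)) x
    (s ^ S m * polygamma (S (S m)) (a + s * x)).
Proof.
  intros H. assert (D := is_derive_polygamma (S m) (a + s * x) H).
  auto_derive.
  - eexists; apply D.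
  - rewrite (is_derive_unique (fun y : R => polygamma (S m) y) _ _ D). simpl. ring.
Qed.

Lemma polygamma_continuity m t : 0 < t -> continuity_pt (polygamma m) t.
Proof.
  intros Ht. apply derivable_continuous_pt. exists (polygamma (S m) t).
  apply is_derive_Reals. now apply is_derive_polygamma.
Qed.

Lemma mean_integrand_continuous a m x s : 0 < a -> - a < x -> 0 <= s <= 1 ->
  continuous (fun s => s ^ m * polygamma (S m) (a + s * x)) s.
Proof.
  intros Ha Hx Hs. assert (D := is_derive_polygamma (S m) _ (segment_pos a x s Ha Hx Hs)).
  apply (ex_derive_continuous (fun s => s ^ m * polygamma (S m) (a + s * x))).
  auto_derive. eexists; apply D.
Qed.

Lemma ex_RInt_mean a m x : 0 < a -> - a < x ->
  ex_RInt (fun s => s ^ m * polygamma (S m) (a + s * x)) 0 1.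
Proof.
  intros Ha Hx. apply (ex_RInt_continuous (fun s => s ^ m * polygamma (S m) (a + s * x))).
  intros s Hs. rewrite Rmin_left, Rmax_right in Hs by lra.
  now apply mean_integrand_continuous.
Qed.

Lemma is_derive_mean_polygamma a m x : 0 < a -> - a < x ->
  is_derive (mean_polygamma a m) x (mean_polygamma a (S m) x).
Proof.
  intros Ha Hx.
  set (f := fun u s => s ^ m * polygamma (S m) (a + s * u)).
  assert (E : RInt (fun s => Derive (fun u => f u s) x) 0 1 = mean_polygamma a (S m) x).
  { apply RInt_ext. intros s Hs. rewrite Rmin_left, Rmax_right in Hs by lra.
    apply is_derive_unique. apply is_derive_mean_integrand. apply segment_pos; auto; lra. }
  rewrite <- E.
  assert (Hloc : locally x (fun y => - a < y)) by now apply open_gt.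
  apply (is_derive_RInt_param f 0 1 x); rewrite ?Rmin_left, ?Rmax_right by lra.
  - revert Hloc. apply filter_imp. intros y Hy s Hs. eexists.
    apply is_derive_mean_integrand. now apply segment_pos.
  - intros s Hs. pose proof (segment_pos a x s Ha Hx Hs) as Hp.
    assert (C0 : continuity_2d_pt (fun u v => a + v * u) x s).
    { apply continuity_2d_pt_plus; [apply continuity_2d_pt_const|].
      apply continuity_2d_pt_mult; [apply continuity_2d_pt_id2 | apply continuity_2d_pt_id1]. }
    apply continuity_2d_pt_ext_loc
      with (fun u v => v ^ S m * polygamma (S (S m)) (a + v * u)).
    + destruct (C0 (mkposreal _ Hp)) as [d Hd]. exists d. intros u v Hu Hv.
      specialize (Hd u v Hu Hv). simpl in Hd. apply Rabs_def2 in Hd.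
      symmetry. apply is_derive_unique. apply is_derive_mean_integrand. lra.
    + apply continuity_2d_pt_mult.
      * apply (continuity_1d_2d_pt_comp (fun v => v ^ S m) (fun u v => v)).
        -- apply derivable_continuous_pt, derivable_pt_pow.
        -- apply continuity_2d_pt_id2.
      * apply (continuity_1d_2d_pt_comp (polygamma (S (S m))) (fun u v => a + v * u)); auto.
        now apply polygamma_continuity.
  - revert Hloc. apply filter_imp. intros y Hy. now apply ex_RInt_mean.
Qed.

(** The polygamma function under the integral has constant sign. *)
Lemma mean_polygamma_sign a m x : 0 < a -> - a < x ->
  (-1) ^ S m * mean_polygamma a (S m) x < 0.
Proof.
  intros Ha Hx.
  assert (H : 0 < (-1) ^ m * mean_polygamma a (S m) x).
  { unfold mean_polygamma.
    rewrite <- (RInt_scal (fun s => s ^ S m * polygamma (S (S m)) (a + s * x))).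
    2: now apply ex_RInt_mean.
    apply RInt_gt_0; try lra.
    - intros s Hs. unfold scal; simpl; unfold mult; simpl.
      pose proof (polygamma_sign m (a + s * x) ltac:(apply segment_pos; auto; lra)).
      assert (0 < s ^ S m) by (apply pow_lt; lra). simpl in H0. nra.
    - intros s Hs. apply (continuous_scal_r ((-1) ^ m)
               (fun s => s ^ S m * polygamma (S (S m)) (a + s * x))).
      now apply mean_integrand_continuous. }
  simpl pow. lra.
Qed.

Lemma mean_polygamma_0 a x : 0 < a -> - a < x ->
  x * mean_polygamma a 0 x = ln (Gamma (x + a)) - ln (Gamma a).
Proof.
  intros Ha Hx. unfold mean_polygamma.
  rewrite <- (RInt_scal (fun s => s ^ 0 * polygamma 1 (a + s * x))) by now apply ex_RInt_mean.
  apply is_RInt_unique.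
  replace (ln (Gamma (x + a)) - ln (Gamma a))
    with (minus (ln (Gamma (a + 1 * x))) (ln (Gamma (a + 0 * x)))).
  2: { unfold minus, plus, opp; simpl. rewrite Rmult_0_l, Rmult_1_l, Rplus_0_r, Rplus_comm.
       rewrite (Rplus_comm a x). ring. }
  apply (is_RInt_derive (fun s => ln (Gamma (a + s * x)))).
  - intros s Hs. rewrite Rmin_left, Rmax_right in Hs by lra.
    assert (D := is_derive_ln_Gamma _ (segment_pos a x s Ha Hx Hs)).
    change (is_derive (fun s => ln_Gamma (a + s * x)) s
              (scal x (s ^ 0 * polygamma 1 (a + s * x)))).
    auto_derive.
    + eexists; apply D.
    + rewrite (is_derive_unique (fun y : R => ln_Gamma y) _ _ D).
      unfold scal; simpl; unfold mult; simpl. ring.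
  - intros s Hs. rewrite Rmin_left, Rmax_right in Hs by lra.
    apply (continuous_scal_r x (fun s => s ^ 0 * polygamma 1 (a + s * x))).
    now apply mean_integrand_continuous.
Qed.

Lemma mean_polygamma_at_0 a : mean_polygamma a 0 0 = polygamma 1 a.
Proof.
  unfold mean_polygamma. rewrite (RInt_ext _ (fun _ => polygamma 1 a)).
  - rewrite RInt_const. unfold scal; simpl; unfold mult; simpl. ring.
  - intros s _. rewrite Rmult_0_r, Rplus_0_r. simpl. ring.
Qed.

Lemma g1_strictly_LCM_family a l (G : nat -> R -> R) :
  (forall x, l < x -> pdom (g1 a) x /\ 0 < g1 a x /\ ln (g1 a x) = G O x) ->
  (forall n x, l < x -> is_derive (G n) x (G (S n) x)) ->
  (forall n x, l < x -> 0 < (-1) ^ S n * G (S n) x) ->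
  strictly_LCM_on (g1 a) (open_itv l p_infty).
Proof.
  intros H0 HG HS. split.
  - intros x Hx. rewrite open_itv_p_infty in Hx. split; now apply H0.
  - intros n x Hn Hx. rewrite open_itv_p_infty in Hx.
    destruct (Derive_n_family (fun y => ln (g1 a y)) G (fun y => l < y) (open_gt l))
      with (n := n) (x := x) as [E1 E2]; auto.
    + intros y Hy. now apply H0.
    + split; auto. rewrite E2. destruct n as [|n]; [lia|]. now apply HS.
Qed.

(** Here ln g1(x) = - L(a)/x - K(x), with L = ln Gamma and K = [mean_polygamma a 0]:
    the second term gives the strict sign, and the first one has the same weak sign
    because L(a) <= 0. *)
Lemma g1_strictly_LCM_half_line a : 1 <= a <= 2 -> strictly_LCM_on (g1 a) (open_itv 0 p_infty).
Proof.
  intros Ha.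
  apply (g1_strictly_LCM_family a 0
    (fun n y => ln (Gamma a) * neg_ln_der (S n) y - mean_polygamma a n y)).
  - intros x Hx. split; [|split].
    + simpl. lra.
    + apply g1_pos. lra.
    + rewrite g1_val, ln_exp by lra.
      pose proof (mean_polygamma_0 a x ltac:(lra) ltac:(lra)) as E.
      replace (ln (Gamma (x + a))) with (x * mean_polygamma a 0 x + ln (Gamma a)) by lra.
      unfold neg_ln_der. simpl. field. lra.
  - intros n x Hx.
    apply (is_derive_minus (fun y => ln (Gamma a) * neg_ln_der (S n) y) (mean_polygamma a n)).
    + apply (is_derive_scal (neg_ln_der (S n))). apply is_derive_neg_ln_der. lra.
    + apply is_derive_mean_polygamma; lra.
  - intros n x Hx.
    pose proof (mean_polygamma_sign a n x ltac:(lra) ltac:(lra)) as HK.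
    pose proof (ln_Gamma_nonpos a Ha) as HL.
    assert (E : (-1) ^ S n * neg_ln_der (S (S n)) x = - (INR (fact (S n)) / x ^ S (S n))).
    { unfold neg_ln_der. replace ((-1) ^ S (S n)) with (- (-1) ^ S n) by (simpl; ring).
      replace ((-1) ^ S n * (- (-1) ^ S n * INR (fact (S n)) / x ^ S (S n)))
        with (- (((-1) ^ S n * (-1) ^ S n) * (INR (fact (S n)) / x ^ S (S n))))
        by (unfold Rdiv; ring).
      rewrite <- Rpow_mult_distr. replace (-1 * -1) with 1 by ring. rewrite pow1. ring. }
    assert (0 < INR (fact (S n)) / x ^ S (S n)).
    { apply Rdiv_lt_0_compat; [apply INR_fact_lt_0 | now apply pow_lt]. }
    rewrite Rmult_minus_distr_l, <- Rmult_assoc, (Rmult_comm _ (ln _)), Rmult_assoc, E.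
    nra.
Qed.

(** As ln Gamma(a) = 0, the singular term is absent and ln g1 is - [mean_polygamma a 0],
    also at 0: there it equals - psi(a), which is gamma for a = 1 and gamma - 1 for
    a = 2. *)
Lemma g1_strictly_LCM_full a : a = 1 \/ a = 2 -> strictly_LCM_on (g1 a) (open_itv (- a) p_infty).
Proof.
  intros Ha. assert (Ha0 : 0 < a) by lra.
  assert (HL : ln (Gamma a) = 0).
  { destruct Ha as [-> | ->]; [rewrite Gamma_1 | rewrite Gamma_2]; apply ln_1. }
  apply (g1_strictly_LCM_family a (- a) (fun n y => - mean_polygamma a n y)).
  - intros x Hx. destruct (Req_EM_T x 0) as [-> | H0].
    + rewrite mean_polygamma_at_0. unfold g1; simpl pval. simpl pdom.
      destruct (Req_EM_T 0 0) as [_ | n]; [|now contradiction n].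
      split; [|destruct Ha as [-> | ->]].
      * split; auto.
      * destruct (Req_EM_T 1 1) as [_ | n]; [|now contradiction n].
        split; [apply exp_pos|]. rewrite ln_exp, polygamma_1_1. ring.
      * destruct (Req_EM_T 2 1) as [n | _]; [lra|].
        destruct (Req_EM_T 2 2) as [_ | n]; [|now contradiction n].
        split; [apply exp_pos|]. rewrite ln_exp.
        replace 2 with (1 + 1) by ring. rewrite polygamma_1_succ, polygamma_1_1; lra.
    + split; [|split].
      * simpl. auto.
      * now apply g1_pos.
      * rewrite g1_val, ln_exp by auto.
        pose proof (mean_polygamma_0 a x Ha0 Hx) as E. rewrite HL, Rminus_0_r in E.
        rewrite <- E. field. auto.
  - intros n x Hx. apply (is_derive_opp (mean_polygamma a n)). now apply is_derive_mean_polygamma.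
  - intros n x Hx. pose proof (mean_polygamma_sign a n x Ha0 Hx). nra.
Qed.

Lemma slope_num_pos_of_LCM a D x : strictly_LCM_on (g1 a) D ->
  D x -> - a < x -> x <> 0 -> 0 < slope_num a x.
Proof.
  intros [_ H] Dx Hx H0. destruct (H 1%nat x) as [_ H1]; auto.
  change (Derive_n (fun y => ln (g1 a y)) 1 x) with (Derive (fun y => ln (g1 a y)) x) in H1.
  rewrite (is_derive_unique (fun y : R => ln (g1 a y)) _ _ (is_derive_ln_g1 a x Hx H0)) in H1.
  assert (0 < slope_num a x / x ^ 2) by lra.
  assert (0 < x ^ 2) by now apply pow2_gt_0.
  replace (slope_num a x) with (slope_num a x / x ^ 2 * x ^ 2) by (field; auto).
  now apply Rmult_lt_0_compat.
Qed.

(** * The monotonicity patterns and their mutual exclusion *)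

Lemma incr_decr_disjoint f D E x y : strictly_increasing_on f D -> strictly_decreasing_on f E ->
  x < y -> D x -> D y -> E x -> E y -> False.
Proof.
  intros [_ H1] [_ H2] Hxy Dx Dy Ex Ey.
  specialize (H1 x y Dx Dy Hxy). specialize (H2 x y Ex Ey Hxy). lra.
Qed.

Lemma slope_num_critical a x : - a < x ->
  slope_num a x = 0 <-> x * digamma (x + a) = ln (Gamma (x + a)).
Proof. intros Hx. unfold slope_num. rewrite digamma_polygamma by lra. lra. Qed.

Lemma g1_shape_nonpos a : a <= 0 ->
  exists x0 : R,
      - a < x0 /\
      x0 * digamma (x0 + a) = ln (Gamma (x0 + a)) /\
      strictly_increasing_on (g1 a) (open_itv (- a) x0) /\
      strictly_decreasing_on (g1 a) (open_itv x0 p_infty).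
Proof.
  intros Ha. destruct (slope_num_signs_nonpos a Ha) as (x0 & H0 & E0 & HN & HP).
  exists x0. split; [|split; [|split]]; auto.
  - now apply slope_num_critical.
  - apply g1_strictly_increasing. intros x Hx. rewrite open_itv_fin in Hx.
    repeat split; try lra. now apply HN.
  - apply g1_strictly_decreasing. intros x Hx. rewrite open_itv_p_infty in Hx.
    repeat split; try lra. now apply HP.
Qed.

Lemma g1_shape_outside a : 0 < a < 1 \/ 2 < a ->
  exists x1 x2 : R,
      - a < x1 /\ - a < x2 /\ x1 < 0 < x2 /\
      x1 * digamma (x1 + a) = ln (Gamma (x1 + a)) /\
      x2 * digamma (x2 + a) = ln (Gamma (x2 + a)) /\
      strictly_decreasing_on (g1 a) (open_itv (- a) x1) /\
      strictly_decreasing_on (g1 a) (open_itv x2 p_infty) /\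
      strictly_increasing_on (g1 a) (open_itv x1 0) /\
      strictly_increasing_on (g1 a) (open_itv 0 x2).
Proof.
  intros Ha.
  destruct (slope_num_signs_outside a Ha) as (x1 & x2 & H1 & H12 & E1 & E2 & P1 & N & P2).
  exists x1, x2. do 3 (split; [lra|]). do 2 (split; [apply slope_num_critical; lra|]).
  split; [|split; [|split]].
  - apply g1_strictly_decreasing. intros x Hx. rewrite open_itv_fin in Hx.
    repeat split; try lra. now apply P1.
  - apply g1_strictly_decreasing. intros x Hx. rewrite open_itv_p_infty in Hx.
    repeat split; try lra. now apply P2.
  - apply g1_strictly_increasing. intros x Hx. rewrite open_itv_fin in Hx.
    repeat split; try lra. apply N. lra.
  - apply g1_strictly_increasing. intros x Hx. rewrite open_itv_fin in Hx.
    repeat split; try lra. apply N. lra.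
Qed.

Lemma g1_shape_inside a : 1 <= a <= 2 ->
  strictly_decreasing_on (g1 a) (open_itv (- a) 0) /\
    strictly_decreasing_on (g1 a) (open_itv 0 p_infty).
Proof.
  intros Ha. split; apply g1_strictly_decreasing; intros x Hx.
  - rewrite open_itv_fin in Hx. repeat split; try lra. apply slope_num_signs_inside; lra.
  - rewrite open_itv_p_infty in Hx. repeat split; try lra. apply slope_num_signs_inside; lra.
Qed.

(** This rules out a > 0 in the increasing-then-decreasing pattern. *)
Lemma g1_decreasing_near_pole a : 0 < a ->
  exists m, - a < m < 0 /\ strictly_decreasing_on (g1 a) (open_itv (- a) m).
Proof.
  intros Ha. destruct (slope_num_pos_near_pole a Ha) as (m & Hm & Pm). exists m. split; auto.
  apply g1_strictly_decreasing. intros x Hx. rewrite open_itv_fin in Hx.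
  repeat split; try lra. pose proof (slope_num_decr a x m). lra.
Qed.

Lemma slope_num_neg_right_of_0 a : a = 0 \/ 0 < a < 1 \/ 2 < a ->
  exists x2, 0 < x2 /\ (forall x, 0 < x < x2 -> slope_num a x < 0).
Proof.
  intros [-> | Ha].
  - destruct (slope_num_signs_nonpos 0 (Rle_refl 0)) as (x0 & H0 & _ & HN & _).
    exists x0. split; [lra|]. intros x Hx. apply HN. lra.
  - destruct (slope_num_signs_outside a Ha) as (x1 & x2 & _ & H12 & _ & _ & _ & N & _).
    exists x2. split; [lra|]. intros x Hx. apply N. lra.
Qed.

(** Both characterizations of 1 <= a <= 2 reduce to this: a < 0 is excluded by the
    domain, and the other values make g1 increase immediately to the right of 0. *)
Lemma inside_if_not_neg_right_of_0 a :
  (forall x, 0 < x -> - a < x) ->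
  (forall x2, 0 < x2 -> ~ (forall x, 0 < x < x2 -> slope_num a x < 0)) -> 1 <= a <= 2.
Proof.
  intros Hd Hn.
  assert (H0 : 0 <= a). { apply Rnot_lt_le. intros Ha. specialize (Hd (- a)). lra. }
  apply Classical_Prop.NNPP. intros Ha.
  destruct (slope_num_neg_right_of_0 a) as (x2 & Hx & Hneg); [lra|]. now apply (Hn x2).
Qed.

Theorem theorem1 (a : R) :
  ((exists x0 : R,
      - a < x0 /\
      x0 * digamma (x0 + a) = ln (Gamma (x0 + a)) /\
      strictly_increasing_on (g1 a) (open_itv (- a) x0) /\
      strictly_decreasing_on (g1 a) (open_itv x0 p_infty))
   <-> a <= 0)
  /\
  ((exists x1 x2 : R,
      - a < x1 /\ - a < x2 /\ x1 < 0 < x2 /\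
      x1 * digamma (x1 + a) = ln (Gamma (x1 + a)) /\
      x2 * digamma (x2 + a) = ln (Gamma (x2 + a)) /\
      strictly_decreasing_on (g1 a) (open_itv (- a) x1) /\
      strictly_decreasing_on (g1 a) (open_itv x2 p_infty) /\
      strictly_increasing_on (g1 a) (open_itv x1 0) /\
      strictly_increasing_on (g1 a) (open_itv 0 x2))
   <-> 0 < a < 1 \/ 2 < a)
  /\
  ((strictly_decreasing_on (g1 a) (open_itv (- a) 0) /\
    strictly_decreasing_on (g1 a) (open_itv 0 p_infty))
   <-> 1 <= a <= 2)
  /\
  (strictly_LCM_on (g1 a) (open_itv 0 p_infty) <-> 1 <= a <= 2)
  /\
  (strictly_LCM_on (g1 a) (open_itv (- a) p_infty) <-> a = 1 \/ a = 2).
Proof.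
  split; [|split; [|split; [|split]]]; split.
  - intros (x0 & H0 & _ & Hinc & _). apply Rnot_lt_le. intros Ha.
    destruct (g1_decreasing_near_pole a Ha) as (m & Hm & Hdec).
    set (e := Rmin m x0 + a).
    assert (He : 0 < e /\ e - a <= m /\ e - a <= x0).
    { unfold e. pose proof (Rmin_l m x0). pose proof (Rmin_r m x0).
      pose proof (Rmin_glb_lt m x0 (- a)). lra. }
    apply (incr_decr_disjoint _ _ _ (- a + e / 3) (- a + e / 2) Hinc Hdec);
      rewrite ?open_itv_fin; lra.
  - apply g1_shape_nonpos.
  - intros (x1 & x2 & H1 & _ & H12 & _ & _ & _ & _ & _ & Hinc).
    apply Classical_Prop.NNPP. intros Ha.
    destruct (g1_shape_inside a) as [_ Hdec]; [lra|].
    apply (incr_decr_disjoint _ _ _ (x2 / 3) (x2 / 2) Hinc Hdec);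
      rewrite ?open_itv_fin, ?open_itv_p_infty; lra.
  - apply g1_shape_outside.
  - intros [_ Hdec]. apply inside_if_not_neg_right_of_0.
    + intros x Hx. apply (proj1 Hdec x). now apply open_itv_p_infty.
    + intros x2 Hx2 Hneg.
      assert (Hd : forall x, 0 < x -> - a < x).
      { intros x Hx. apply (proj1 Hdec x). now apply open_itv_p_infty. }
      assert (Hinc : strictly_increasing_on (g1 a) (open_itv 0 x2)).
      { apply g1_strictly_increasing. intros x Hx. rewrite open_itv_fin in Hx.
        repeat split; try lra; auto. apply Hd; lra. }
      apply (incr_decr_disjoint _ _ _ (x2 / 3) (x2 / 2) Hinc Hdec);
        rewrite ?open_itv_fin, ?open_itv_p_infty; lra.
  - apply g1_shape_inside.
  - intros H.
    assert (Hd : forall x, 0 < x -> - a < x).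
    { intros x Hx. apply (proj1 H x). now apply open_itv_p_infty. }
    apply inside_if_not_neg_right_of_0; auto.
    intros x2 Hx2 Hneg. specialize (Hneg (x2 / 2) ltac:(lra)).
    assert (0 < slope_num a (x2 / 2)).
    { apply slope_num_pos_of_LCM with (1 := H); try lra.
      - apply open_itv_p_infty. lra.
      - apply Hd. lra. }
    lra.
  - apply g1_strictly_LCM_half_line.
  - intros H. destruct (Rle_lt_dec a 0) as [Ha | Ha].
    + destruct (slope_num_neg_near_pole a Ha) as (x & Hx & Nx).
      assert (0 < slope_num a x).
      { apply slope_num_pos_of_LCM with (1 := H); try lra. now apply open_itv_p_infty. }
      lra.
    + destruct (proj1 H 0) as [Hdom _]. { apply open_itv_p_infty. lra. }
      simpl in Hdom. destruct Hdom as [_ [Hdom | [Hdom | Hdom]]]; lra.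
  - apply g1_strictly_LCM_full.
Qed.
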